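(* For every $n\ge1$ and every $w\in S_n$, $$\mathfrak G_w^q=\mathfrak G^q_{w^{-1}}(y,x)\big|_{y=0},$$ where $\mathfrak G_w^q=\mathfrak G_w^q(x)$ is the quantum Grothendieck polynomial, $\mathfrak G^q_{w^{-1}}(x,y)$ is the quantum double Grothendieck polynomial of $w^{-1}$, and $\mathfrak G^q_{w^{-1}}(y,x)$ is obtained from it by exchanging the $x$ and $y$ variables.
   Context: Permutations are composed as functions; $w_\circ=(n,n-1,\ldots,1)$ is the longest element of $S_n$ in one-line notation. Operators and Grothendieck polynomials: $\partial_i=\frac{1-s_i}{x_i-x_{i+1}}$ ($s_i$ exchanging $x_i,x_{i+1}$), $\pi_i=1+(1-x_i)\partial_i$, $\pi_u=\pi_{i_1}\cdots\pi_{i_l}$ for a reduced decomposition $u=s_{i_1}\cdots s_{i_l}$ (well defined). For $w\in S_n$: $\mathfrak G_{w_\circ}=\prod_{i=1}^{n-1}x_i^{n-i}$ and $\mathfrak G_w=\pi_{w^{-1}w_\circ}\mathfrak G_{w_\circ}$. Quantum Grothendieck polynomials: let $e_p^k=e_p(x_1,\ldots,x_k)$ be the elementary symmetric polynomial. For $0\le p\le k$ let $F_0^k=1$ and, for $p\ge1$, $$F_p^k=\sum_{I\subseteq\{1,\ldots,k\},\,|I|=p}\ \prod_{i\in I}(1-x_i)\prod_{i\in I,\ i+1\notin I}(1-q_i),\qquad \widehat E_p^k=\sum_{i=0}^p(-1)^i\binom{k-i}{p-i}F_i^k .$$ Let $L_n$ be the $\mathbb Z$-span of the monomials $x_1^{i_1}\cdots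 x_{n-1}^{i_{n-1}}$ with $0\le i_j\le n-j$ and $L_n^q=\mathbb Z[q_1,\ldots,q_{n-1}]\otimes L_n$. The products $e_{p_1}^1\cdots e_{p_{n-1}}^{n-1}$, $0\le p_i\le i$, form a $\mathbb Z$-basis of $L_n$, and $\mathfrak G_w\in L_n$ for $w\in S_n$. Let $\widehat Q:L_n^q\to L_n^q$ be the $\mathbb Z[q_1,\ldots,q_{n-1}]$-linear map with $\widehat Q(e_{p_1}^1\cdots e_{p_{n-1}}^{n-1})=\widehat E_{p_1}^1\cdots\widehat E_{p_{n-1}}^{n-1}$. For $w\in S_n$, $\mathfrak G_w^q:=\widehat Q(\mathfrak G_w)$. Quantum double Grothendieck polynomials: $$\mathfrak G^q_{w_\circ}(x,y):=\prod_{i=1}^{n-1}\Big(1+\sum_{j=1}^i(-1)^j(1-x_{n-i})^jF_j^i(y)\Big),\qquad \mathfrak G_w^q(x,y):=\pi^{(x)}_{w^{-1}w_\circ}\mathfrak G^q_{w_\circ}(x,y)\quad(w\in S_n),$$ where $F_j^i(y)$ is $F_j^i$ with $x$ replaced by $y$, and $\pi^{(x)}_u$ is the operator $\pi_u$ acting on the $x$ variables only. *)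

(* Defs.v *)
From mathcomp Require Import all_boot all_fingroup all_algebra.
From mathcomp Require Export mpoly.
From Stdlib Require Import ClassicalEpsilon.

Set Implicit Arguments.
Unset Strict Implicit.
Unset Printing Implicit Defensive.

Import GRing.Theory.

Local Open Scope ring_scope.

(* Throughout n = m.+1.  The variables x_1, ..., x_n are indexed by 'I_m.+1,   *)
(* the variables q_1, ..., q_(n-1) and the generators s_1, ..., s_(n-1) by     *)
(* 'I_m, everything being shifted to start from 0.                            *)

Definition lo (m : nat) (i : 'I_m) : 'I_m.+1 := widen_ord (leqnSn m) i.
Definition hi (m : nat) (i : 'I_m) : 'I_m.+1 := lift ord0 i.

(* The product of 'S_n in MathComp is (u * v) x = v (u x); permutations are    *)
(* composed here as functions.                                                *)
Definition permcomp (m : nat) (u v : 'S_m.+1) : 'S_m.+1 := (v * u)%g.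

Lemma permcompE (m : nat) (u v : 'S_m.+1) x : permcomp u v x = u (v x).
Proof. by rewrite permM. Qed.

Definition sadj (m : nat) (i : 'I_m) : 'S_m.+1 := tperm (lo i) (hi i).

Definition w0 (m : nat) : 'S_m.+1 := perm (@rev_ord_inj m.+1).

Definition word_perm (m : nat) (s : seq 'I_m) : 'S_m.+1 :=
  foldr (fun i u => permcomp (sadj i) u) 1%g s.

Definition reduced_for (m : nat) (u : 'S_m.+1) (s : seq 'I_m) : bool :=
  (word_perm s == u) &&
  [forall l : 'I_(size s), forall t : l.-tuple 'I_m, word_perm t != u].

Lemma word_perm_cat (m : nat) (s t : seq 'I_m) :
  word_perm (s ++ t) = permcomp (word_perm s) (word_perm t).
Proof. by elim: s => [|i s IHs] /=; rewrite /permcomp ?mulg1 // IHs mulgA. Qed.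

Lemma word_perm_tperm (m : nat) (i j : 'I_m.+1) :
  exists s : seq 'I_m, word_perm s = tperm i j.
Proof.
wlog lt_ij : i j / (i < j)%N => [IH|].
  case: (ltngtP i j) => [/IH //|/IH [s def_s]|/val_inj->].
    by exists s; rewrite tpermC.
  by exists [::]; rewrite tperm1.
have [d] := ubnP (j - i)%N; elim: d i j lt_ij => // d IHd i j lt_ij le_d.
have lt_im : (i < m)%N by rewrite -ltnS (leq_trans _ (ltn_ord j)) // ltnS.
pose k := Ordinal lt_im.
have lo_k : lo k = i by apply: val_inj.
have hi_k : hi k = i.+1 :> nat by [].
have [eq_j|ne_j] := eqVneq (hi k) j.
  by exists [:: k]; rewrite /= /permcomp mul1g /sadj lo_k eq_j.
have lt_kj : (hi k < j)%N by rewrite ltn_neqAle ne_j hi_k.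
have [|s def_s] := IHd _ _ lt_kj.
  by move: le_d; rewrite hi_k !ltnS; apply: leq_trans; rewrite ltn_sub2l.
exists (k :: s ++ [:: k]).
rewrite /= word_perm_cat def_s /permcomp /= /permcomp mul1g.
have -> : sadj k = tperm (hi k) i by rewrite /sadj lo_k tpermC.
rewrite -[X in (X * _ * _)%g]tpermV -mulgA -[LHS]/(_ ^ _)%g tpermJ tpermL.
by rewrite tpermD // -?val_eqE /= ?hi_k ?ltn_eqF.
Qed.

Lemma reduced_for_ex (m : nat) (u : 'S_m.+1) : exists s, reduced_for u s.
Proof.
have ex_l : exists l, [exists t : l.-tuple 'I_m, word_perm t == u].
  suff [s def_s] : exists s : seq 'I_m, word_perm s = u.
    by exists (size s); apply/existsP; exists (in_tuple s); apply/eqP.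
  have [ts -> _] := prod_tpermP u.
  elim: ts => [|t ts [s IHs]]; first by exists [::]; rewrite big_nil.
  have [s' def_s'] := word_perm_tperm t.1 t.2.
  by exists (s ++ s'); rewrite word_perm_cat IHs def_s' big_cons.
have [l /existsP[s def_s] min_l] := ex_minnP ex_l.
exists s; rewrite /reduced_for def_s; apply/forallP=> k.
rewrite -negb_exists; apply/negP => /min_l.
by rewrite leqNgt -[X in (_ < X)%N](size_tuple s) ltn_ord.
Qed.

Definition reduced_word (m : nat) (u : 'S_m.+1) : seq 'I_m :=
  xchoose (reduced_for_ex u).

Lemma dvd_msym_adj (m : nat) (R : idomainType) (i : 'I_m)
    (f : {mpoly R[m.+1]}) :
  exists g, ('X_(lo i) - 'X_(hi i)) * g == f - msym (sadj i) f.
Proof.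
pose P (f : {mpoly R[m.+1]}) :=
  exists g, ('X_(lo i) - 'X_(hi i)) * g = f - msym (sadj i) f.
have PC c : P c%:MP by exists 0; rewrite mulr0 [msym _ _]mmapC subrr.
have PD f1 f2 : P f1 -> P f2 -> P (f1 + f2).
  move=> [g1 e1] [g2 e2]; exists (g1 + g2).
  by rewrite mulrDr e1 e2 msymD opprD addrACA.
have PM f1 f2 : P f1 -> P f2 -> P (f1 * f2).
  move=> [g1 e1] [g2 e2]; exists (g1 * f2 + msym (sadj i) f1 * g2).
  rewrite mulrDr mulrA e1 mulrCA e2 msymM mulrBl mulrBr addrA.
  by rewrite subrK.
have PX k : P 'X_k.
  rewrite /P; have -> : msym (sadj i) ('X_k : {mpoly R[m.+1]}) = 'X_(sadj i k).
    by rewrite [LHS]mmapX mmap1U.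
  have [->|ne_lo] := eqVneq k (lo i).
    by exists 1; rewrite mulr1 tpermL.
  have [->|ne_hi] := eqVneq k (hi i).
    by exists (-1); rewrite mulrN1 tpermR opprB.
  by exists 0; rewrite mulr0 tpermD 1?eq_sym // subrr.
suff [g def_g] : P f by exists g; apply/eqP.
elim/mpolyind: f => [|c mo f _ _ IHf]; first by rewrite -mpolyC0.
apply: (PD) => //; rewrite -mul_mpolyC mpolyXE_id; apply: (PM) => //.
apply: big_ind => [||k _]; [by rewrite -mpolyC1 | exact: (PM) |].
by elim: (mo k) => [|a IHa]; rewrite ?expr0 -?mpolyC1 // exprS; apply: (PM).
Qed.

Definition ddiff (m : nat) (R : idomainType) (i : 'I_m) (f : {mpoly R[m.+1]}) :
  {mpoly R[m.+1]} := xchoose (dvd_msym_adj i f).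

Lemma ddiffP (m : nat) (R : idomainType) (i : 'I_m) (f : {mpoly R[m.+1]}) :
  ('X_(lo i) - 'X_(hi i)) * ddiff i f = f - msym (sadj i) f.
Proof. exact/eqP/(xchooseP (dvd_msym_adj i f)). Qed.

Definition piop (m : nat) (R : idomainType) (i : 'I_m) (f : {mpoly R[m.+1]}) :
  {mpoly R[m.+1]} := f + (1 - 'X_(lo i)) * ddiff i f.

(* By the braid relations the choice of the reduced word is immaterial. *)
Definition piperm (m : nat) (R : idomainType) (u : 'S_m.+1)
    (f : {mpoly R[m.+1]}) : {mpoly R[m.+1]} :=
  foldr (fun i g => piop i g) f (reduced_word u).

Definition groth (m : nat) (w : 'S_m.+1) : {mpoly int[m.+1]} :=
  piperm (permcomp w^-1%g (w0 m)) (\prod_(i < m) 'X_(lo i) ^+ (m - i)).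

(* Z[q_1, ..., q_(n-1)], and its extension by n further variables *)
Notation Zq m := {mpoly int[m]}.
Notation Zqx m := {mpoly (Zq m)[m.+1]}.

(* e_p(x_1, ..., x_k), for k <= n *)
Definition elsym (m p k : nat) : Zqx m :=
  mesym k {mpoly int[m]} p \mPo [tuple 'X_(inord i) | i < k].

(* F_p^k for k <= n - 1; for p = 0 the sum is the empty product 1. *)
Definition Fq (m p k : nat) : Zqx m :=
  \sum_(I : {set 'I_m} | (#|I| == p) && [forall i in I, (i < k)%N])
     (\prod_(i in I) (1 - 'X_(lo i))) *
     (\prod_(i in I | [forall j in I, j != i.+1 :> nat]) (1 - 'X_i)%:MP).

Definition Ehat (m p k : nat) : Zqx m :=
  \sum_(i < p.+1) (-1) ^+ i * Fq m i k *+ 'C(k - i, p - i).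

Definition in_Lq (m : nat) (f : Zqx m) : Prop :=
  forall mo, mo \in msupp f -> forall j : 'I_m.+1, (mo j <= m - j)%N.

Definition is_Qhat (m : nat) (Q : Zqx m -> Zqx m) : Prop :=
  [/\ forall f, in_Lq f -> in_Lq (Q f),
      forall (c : Zq m) f g, in_Lq f -> in_Lq g ->
        Q (c *: f + g) = c *: Q f + Q g
    & forall p : 'I_m -> nat, (forall i, (p i <= i.+1)%N) ->
        Q (\prod_(i < m) elsym m (p i) i.+1) = \prod_(i < m) Ehat m (p i) i.+1].

(* [is_Qhat] determines the values on L_n^q, the products of elementary        *)
(* symmetric polynomials being a basis of it; elsewhere Qhat is arbitrary.    *)
Definition Qhat (m : nat) : Zqx m -> Zqx m := epsilon (inhabits id) (@is_Qhat m).

Definition qgroth (m : nat) (w : 'S_m.+1) : Zqx m :=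
  Qhat (map_mpoly (@mpolyC m int) (groth w)).

(* Z[q][x, y]: the x variables are the outer ones, the y variables belong to   *)
(* the coefficients, so that piperm acts on the x variables only.             *)
Notation Zqxy m := {mpoly (Zqx m)[m.+1]}.

(* rev_ord i is the (shifted) index n - i of the i-th factor. *)
Definition qdgroth_w0 (m : nat) : Zqxy m :=
  \prod_(i < m) (1 + \sum_(1 <= j < i.+2)
     (-1) ^+ j * (1 - 'X_(lo (rev_ord i))) ^+ j * (Fq m j i.+1)%:MP).

Definition qdgroth (m : nat) (w : 'S_m.+1) : Zqxy m :=
  piperm (permcomp w^-1%g (w0 m)) (qdgroth_w0 m).

Definition swap_xy (m : nat) (f : Zqxy m) : Zqxy m :=
  mmap (map_mpoly (@mpolyC m.+1 (Zq m))) (fun i => ('X_i)%:MP) f.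

Definition y_zero (m : nat) (f : Zqxy m) : Zqx m :=
  map_mpoly (meval (fun _ => 0)) f.

(* Main.v *)
From HB Require Import structures.
Require Import Defs.
From mathcomp Require Import all_boot all_fingroup all_algebra.
From mathcomp Require Import ring zify.
From Stdlib Require Import ClassicalEpsilon.

Set Implicit Arguments.
Unset Strict Implicit.
Unset Printing Implicit Defensive.

Import GRing.Theory.

Local Open Scope ring_scope.

(* Let K(x, y) be the product of the x_a + y_b - x_a y_b over a + b <= n.      *)
(* Exactly one of its factors is not symmetric in x_i, x_(i+1), and pi_i in    *)
(* the x variables just erases it; the same factor is erased by pi_(n-i) in    *)
(* the y variables.  The two families of operators commute, so that pi^(x)_u K *)
(* can be computed in the y variables along the reversed word, and at x = 0    *)
(* this gives G_w(y) for u = w w_0.                                            *)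
(*   On the other hand, K is a combination of products of the e_p^k(y), one    *)
(* for each k < n, with coefficients free of y, and the binomial theorem shows *)
(* that quantization in y turns K into G^q_(w_0)(x, y).  As quantization acts  *)
(* on the coefficients, it commutes with pi^(x)_u and with x := 0.             *)

(** * Reduced words *)

(** The two sides are linked by K(x, y) = [kernel], through two properties. Duality: pi_i in x and
    pi_(n-i) in y agree on K ([piop_kernel], [map_piop_kernel]), and operators in x commute with
    operators in y ([map_piop]). A word of operators in x thus becomes the reversed and reflected
    word in y ([foldr_piop_kernel]). This turns a reduced word of w w_0 into one of w^-1 w_0, and at
    x = 0 the kernel is the staircase monomial in y. Hence G_w(y) is the constant term in x of
    pi^(x)_(w w_0) K ([piperm_kernel]); this uses that pi_u is independent of the reduced word
    ([eq_reduced_op], [piop_comm], [piop_braid]). Quantization: the row of K with k factors expands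
    into terms x^(k-p) (1-x)^p e_p^k(y) ([kernel_stair_sum]), and replacing each e_p^k by its
    quantum version gives G^q_(w_0)(x, y) ([qdgroth_w0_stair_sum]). Being linear over Z[q],
    quantization in y passes through pi^(x) and the constant term ([additive_piperm]); and w w_0 is
    the permutation that defines G^q_(w^-1). The quantization map exists because the products of the
    e_p^k span the staircase monomials ([staircase_span]) and are equally many ([Qhat_exists]). That
    G_w lies in L_n^q follows from the same kernel formula, with [Lq_proj] in place of
    quantization. *)

Lemma sadjE m (i : 'I_m) (a : 'I_m.+1) :
  sadj i a = (if a == i :> nat then i.+1 else
              if a == i.+1 :> nat then i : nat else a) :> nat.
Proof.
rewrite /sadj; case: tpermP => [->|->|].
- by rewrite /= eqxx.
- by rewrite /= /bump /= add1n eqxx gtn_eqF.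
move=> /eqP; rewrite -val_eqE /= => /negbTE-> /eqP.
by rewrite -val_eqE /= /bump /= add1n => /negbTE->.
Qed.

Lemma sadjK m (i : 'I_m) : (sadj i * sadj i = 1)%g.
Proof. exact: tperm2. Qed.

Lemma sadj_lo m (i : 'I_m) : sadj i (lo i) = hi i.
Proof. exact: tpermL. Qed.

Lemma sadj_hi m (i : 'I_m) : sadj i (hi i) = lo i.
Proof. exact: tpermR. Qed.

Lemma sadj_comm m (i j : 'I_m) :
  (i.+1 < j)%N -> (sadj i * sadj j = sadj j * sadj i)%g.
Proof.
move=> lt_ij; apply/permP=> a; apply: val_inj; rewrite /= !permM !sadjE.
by repeat case: eqP; lia.
Qed.

Lemma sadj_braid m (i j : 'I_m) : j = i.+1 :> nat ->
  (sadj i * sadj j * sadj i = sadj j * sadj i * sadj j)%g.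
Proof.
move=> eq_j; apply/permP=> a; apply: val_inj; rewrite /= !permM !sadjE.
by repeat case: eqP; lia.
Qed.

Definition ninv n (v : 'S_n) : nat :=
  \sum_(p : 'I_n * 'I_n | (p.1 < p.2)%N) (v p.2 < v p.1)%N.

(** Exchanging two adjacent positions permutes all the other pairs of positions and keeps their
    order; only the pair (i, i+1) itself turns into an inversion. *)
Lemma ninv_sadj m (i : 'I_m) (v : 'S_m.+1) :
  (v (lo i) < v (hi i))%N -> ninv (sadj i * v)%g = (ninv v).+1.
Proof.
move=> lt_v; have lohi : (lo i < hi i)%N by [].
rewrite /ninv (bigD1 (lo i, hi i)) //=.
rewrite (bigD1 (lo i, hi i) (F := fun p => _ (v _ < _ _)%N)) //=.
rewrite !permM sadj_lo sadj_hi lt_v [(v (hi i) < _)%N]ltnNge ltnW // add1n add0n.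
congr _.+1; pose h (p : 'I_m.+1 * 'I_m.+1) := (sadj i p.1, sadj i p.2).
have hK : involutive h by case=> a b; rewrite /h /= /sadj !tpermK.
rewrite (reindex_inj (inv_inj hK)) /=; apply: eq_big => [[a b]|[a b] _] /=.
  rewrite /h /= !sadjE !xpair_eqE -!val_eqE /= !sadjE /= /bump /=.
  by repeat case: eqP; lia.
by rewrite !permM /sadj !tpermK.
Qed.

Lemma ninv_sadj_desc m (i : 'I_m) (v : 'S_m.+1) :
  (v (hi i) < v (lo i))%N -> ninv v = (ninv (sadj i * v)%g).+1.
Proof.
move=> lt_v; have := @ninv_sadj m i (sadj i * v)%g.
by rewrite mulgA sadjK mul1g => -> //; rewrite !permM sadj_lo sadj_hi.
Qed.

Lemma ltn_perm_lohi m (i : 'I_m) (v : 'S_m.+1) :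
  (v (hi i) < v (lo i))%N = ~~ (v (lo i) < v (hi i))%N.
Proof.
rewrite ltnNge leq_eqVlt (inj_eq val_inj) (inj_eq perm_inj).
by rewrite -val_eqE /= /bump /= add1n ltn_eqF.
Qed.

Lemma ninv_sadj_le m (i : 'I_m) (v : 'S_m.+1) :
  (ninv (sadj i * v)%g <= (ninv v).+1)%N.
Proof.
case: (ltnP (v (lo i)) (v (hi i))) => [/ninv_sadj -> //|].
by rewrite leqNgt -ltn_perm_lohi => /ninv_sadj_desc ->; lia.
Qed.

Lemma ascending_perm1 m (v : 'S_m.+1) :
  (forall i : 'I_m, (v (lo i) < v (hi i))%N) -> v = 1%g.
Proof.
(* An increasing v satisfies k <= v k; as both sides have the same sum over k, equality holds
   everywhere. *)
move=> incr_v; have le_v (k : 'I_m.+1) : (k <= v k)%N.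
  case: k => k; elim: k => // k IHk lt_k.
  have := incr_v (Ordinal (lt_k : (k < m)%N)); have := IHk (ltnW lt_k).
  have -> : lo (Ordinal (lt_k : (k < m)%N)) = Ordinal (ltnW lt_k).
    exact: val_inj.
  have -> : hi (Ordinal (lt_k : (k < m)%N)) = Ordinal lt_k.
    exact: val_inj.
  by move=> /= *; lia.
have /leqif_sum := fun (k : 'I_m.+1) (_ : true) => leqif_eq (le_v k).
have -> : (\sum_(k < m.+1) v k = \sum_(k < m.+1) k)%N.
  by rewrite [RHS](reindex_inj (@perm_inj _ v)).
case=> _; rewrite eqxx => /esym/forallP eq_v; apply/permP=> k; rewrite perm1.
by apply/esym/val_inj/eqP/(eq_v k).
Qed.

(** The reason for working with inverses: the first letter of a word exchanges two positions of the
    inverse permutation, where [ninv_sadj] applies. *)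
Lemma word_permV_cons m (i : 'I_m) s :
  ((word_perm (i :: s))^-1 = sadj i * (word_perm s)^-1)%g.
Proof. by rewrite /= /permcomp invMg tpermV. Qed.

Lemma ninv_word_le m (s : seq 'I_m) :
  (ninv (word_perm s)^-1%g <= size s)%N.
Proof.
elim: s => [|i s IHs].
  rewrite /ninv invg1 big1 // => p lt_p; rewrite !perm1.
  by rewrite ltnNge ltnW.
by rewrite word_permV_cons (leq_trans (ninv_sadj_le _ _)).
Qed.

(** Bubble sort: each exchange at a descent removes exactly one inversion. *)
Lemma word_of_ninv m (v : 'S_m.+1) :
  exists2 s : seq 'I_m, (word_perm s)^-1%g = v & size s = ninv v.
Proof.
have [d] := ubnP (ninv v); elim: d v => // d IHd v lt_d.
case: (pickP (fun i : 'I_m => (v (hi i) < v (lo i))%N)) => [i lt_v|desc0].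
  have eq_n := ninv_sadj_desc lt_v.
  have [|s def_s sz_s] := IHd (sadj i * v)%g; first by rewrite -ltnS -eq_n.
  exists (i :: s); last by rewrite /= sz_s.
  by rewrite word_permV_cons def_s mulgA sadjK mul1g.
have v1 : v = 1%g.
  by apply: ascending_perm1 => i; apply: negbNE; rewrite -ltn_perm_lohi desc0.
exists [::]; rewrite ?v1 ?invg1 // /ninv big1 // => p lt_p; rewrite !perm1.
by rewrite ltnNge ltnW.
Qed.

Lemma reduced_size m (u : 'S_m.+1) s :
  reduced_for u s -> size s = ninv (word_perm s)^-1%g.
Proof.
case/andP=> /eqP def_u /forallP min_s; apply/eqP.
rewrite eqn_leq ninv_word_le andbT leqNgt; apply/negP => lt_n.
have [t def_t sz_t] := word_of_ninv (word_perm s)^-1%g.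
have lt_t : (size t < size s)%N by rewrite sz_t.
have /forallP/(_ (in_tuple t)) := min_s (Ordinal lt_t).
by rewrite /= -def_u -[word_perm t]invgK def_t invgK eqxx.
Qed.

(** * Independence of the reduced word *)

Section Matsumoto.

Variables (m : nat) (X : Type) (T : 'I_m -> X -> X).
Hypothesis T_comm : forall (i j : 'I_m) x,
  (i.+1 < j)%N -> T i (T j x) = T j (T i x).
Hypothesis T_braid : forall (i j : 'I_m) x, j = i.+1 :> nat ->
  T i (T j (T i x)) = T j (T i (T j x)).

Let word_op s x := foldr T x s.
Let red (s : seq 'I_m) := size s = ninv (word_perm s)^-1%g.

(* A left descent of u is a position where u^-1 decreases. *)
Let red_cons i s : red (i :: s) ->
  red s /\ ((word_perm (i :: s))^-1%g (hi i) < (word_perm (i :: s))^-1%g (lo i))%N.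
Proof.
rewrite /red word_permV_cons /= => sz_s.
have le_s := ninv_word_le s; have le_i := ninv_sadj_le i (word_perm s)^-1%g.
split; first lia.
rewrite !permM sadj_lo sadj_hi; case: ltnP => //.
by rewrite leqNgt -ltn_perm_lohi => /ninv_sadj_desc; lia.
Qed.

Let red_ext i s v : (word_perm s)^-1%g = (sadj i * v)%g ->
  (v (hi i) < v (lo i))%N -> red s ->
  red (i :: s) /\ (word_perm (i :: s))^-1%g = v.
Proof.
move=> def_s desc_i red_s.
have def_v : (word_perm (i :: s))^-1%g = v.
  by rewrite word_permV_cons def_s mulgA sadjK mul1g.
by split; rewrite // /red def_v (ninv_sadj_desc desc_i) -def_s -red_s.
Qed.

(* Two left descents i and j of u make the longest element of <s_i, s_j> a     *)
(* left factor of u, so that both words can be brought, by induction, to the   *)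
(* two sides of a commutation or braid relation followed by the same word.     *)
Lemma eq_reduced_op s t x : red s -> red t -> word_perm s = word_perm t ->
  word_op s x = word_op t x.
Proof.
have [d] := ubnP (size s); elim: d s t => // d IHd s t.
have eq_size s1 t1 : red s1 -> red t1 -> word_perm s1 = word_perm t1 ->
    size s1 = size t1 by rewrite /red => -> -> ->.
case: s => [|i s] lt_d red_s; case: t => [|j t] red_t eq_st //.
- by have := eq_size _ _ red_s red_t eq_st.
- by have := eq_size _ _ red_s red_t eq_st.
have [red_s' desc_i] := red_cons red_s; have [red_t' desc_j] := red_cons red_t.
have [sz_st] := eq_size _ _ red_s red_t eq_st.
set v := (word_perm (i :: s))^-1%g in desc_i; rewrite -eq_st -/v in desc_j.
have def_s : ((word_perm s)^-1 = sadj i * v)%g.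
  by rewrite /v word_permV_cons mulgA sadjK mul1g.
have def_t : ((word_perm t)^-1 = sadj j * v)%g.
  by rewrite /v eq_st word_permV_cons mulgA sadjK mul1g.
(* By induction the tails [s] and [t] may be exchanged for any reduced words of the same
   permutations. *)
have op_s r : red r -> (word_perm r)^-1%g = (sadj i * v)%g ->
    word_op s x = word_op r x.
  by move=> red_r def_r; apply: IHd => //; apply: invg_inj; rewrite def_r.
have op_t r : red r -> (word_perm r)^-1%g = (sadj j * v)%g ->
    word_op t x = word_op r x.
  move=> red_r def_r; apply: IHd => //; first by rewrite -sz_st.
  by apply: invg_inj; rewrite def_r.
rewrite /= -!/(word_op _ _).
clearbody v; clear - T_comm T_braid red_ext red_s' red_t' op_s op_t desc_i
  desc_j def_s def_t.
wlog le_ij : i j s t red_s' red_t' op_s op_t desc_i desc_j def_s def_t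
    / (i <= j)%N => [IH|].
  by case: (leqP i j) => [|/ltnW] le; [|apply/esym]; apply: IH le.
move: le_ij; rewrite leq_eqVlt => /predU1P[/val_inj eq_ij|].
  by rewrite -eq_ij in op_t def_t *; rewrite (op_t s).
have sadj_out (k l : 'I_m) : (k.+1 < l)%N || (l.+1 < k)%N ->
    sadj k (lo l) = lo l /\ sadj k (hi l) = hi l.
  move=> lt_kl; split; apply: val_inj; rewrite /= sadjE /=;
    by repeat case: eqP; rewrite /bump /=; lia.
rewrite leq_eqVlt => /predU1P[eq_j|lt_ij].
  have hi_i : hi i = lo j by apply: val_inj; rewrite /= /bump.
  have sj_i : sadj j (lo i) = lo i.
    by apply: val_inj; rewrite /= sadjE /=; repeat case: eqP; lia.
  have si_j : sadj i (hi j) = hi j.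
    by apply: val_inj; rewrite /= sadjE /= /bump /=; repeat case: eqP; lia.
  have si_lo : sadj i (lo j) = lo i by rewrite -hi_i sadj_hi.
  have sj_hi : sadj j (hi i) = hi j by rewrite hi_i sadj_lo.
  have eq_braid := sadj_braid (esym eq_j).
  have [r def_r red_r] :=
    word_of_ninv (sadj i * (sadj j * (sadj i * v)))%g.
  rewrite -def_r in red_r.
  (* The values of v at the three positions involved decrease, so each letter put back in front of
     [r] meets a descent. *)
  have lt_PS : (v (hi j) < v (lo i))%N by rewrite (ltn_trans desc_j) -?hi_i.
  have [|red_ir def_ir] := red_ext def_r _ red_r.
    by rewrite !permM sj_i sadj_lo sj_hi si_j -hi_i in desc_j *.
  have [|red_jir def_jir] := red_ext def_ir _ red_ir.
    by rewrite !permM si_j si_lo.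
  have {}def_r : ((word_perm r)^-1 = sadj j * (sadj i * (sadj j * v)))%g.
    by rewrite def_r !mulgA eq_braid.
  have [|red_jr def_jr] := red_ext def_r _ red_r.
    by rewrite !permM si_j sadj_hi si_lo sj_i -hi_i.
  have [|red_ijr def_ijr] := red_ext def_jr _ red_jr.
    by rewrite !permM sj_hi sj_i.
  rewrite (op_s [:: j, i & r]) // (op_t [:: i, j & r]) //=.
  exact: T_braid (esym eq_j).
have [si_lo si_hi] : sadj i (lo j) = lo j /\ sadj i (hi j) = hi j.
  by apply: sadj_out; rewrite lt_ij.
have [sj_lo sj_hi] : sadj j (lo i) = lo i /\ sadj j (hi i) = hi i.
  by apply: sadj_out; rewrite lt_ij orbT.
have [r def_r red_r] := word_of_ninv (sadj j * (sadj i * v))%g.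
rewrite -def_r in red_r.
have [|red_jr def_jr] := red_ext def_r _ red_r.
  by rewrite !permM si_lo si_hi.
have {}def_r : ((word_perm r)^-1 = sadj i * (sadj j * v))%g.
  by rewrite def_r !mulgA (sadj_comm lt_ij).
have [|red_ir def_ir] := red_ext def_r _ red_r.
  by rewrite !permM sj_lo sj_hi.
by rewrite (op_s (j :: r)) // (op_t (i :: r)) //= T_comm.
Qed.

End Matsumoto.

(** * Demazure operators *)

Section MapMpoly.

Variables (n : nat) (R S : comNzRingType) (phi : {additive R -> S}).

Lemma map_mpoly_ZX c mo :
  map_mpoly phi (c *: 'X_[mo] : {mpoly R[n]}) = phi c *: 'X_[mo].
Proof.
apply/mpolyP=> mo'; rewrite mcoeff_map_mpoly !mcoeffZ !mcoeffX.
by case: eqP; rewrite ?mulr1 // !mulr0 raddf0.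
Qed.

(** Here [phi] is only additive, since operators such as [piop] and [quantize] will be applied to
    coefficients. Multiplicativity is then available only for simple factors; variables are enough
    for [map_piop]. *)
Lemma map_mpolyXM k (p : {mpoly R[n]}) :
  map_mpoly phi ('X_k * p) = 'X_k * map_mpoly phi p.
Proof.
elim/mpolyind: p => [|c mo p _ _ IHp]; first by rewrite mulr0 !raddf0 mulr0.
rewrite mulrDr !raddfD mulrDr /= IHp; congr (_ + _).
by rewrite -scalerAr -mpolyXD !map_mpoly_ZX -scalerAr -mpolyXD.
Qed.

Lemma map_msym (s : 'S_n) (p : {mpoly R[n]}) :
  map_mpoly phi (msym s p) = msym s (map_mpoly phi p).
Proof. by apply/mpolyP=> mo; rewrite !(mcoeff_map_mpoly, mcoeff_sym). Qed.

End MapMpoly.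

Section Piop.

Variables (m : nat) (R : idomainType).
Implicit Types (i j : 'I_m) (f g : {mpoly R[m.+1]}).

Lemma msymXU s k : msym s ('X_k : {mpoly R[m.+1]}) = 'X_(s k).
Proof. by rewrite [LHS]mmapX mmap1U. Qed.

Lemma mpolyXU_inj : injective (fun k => 'X_k : {mpoly R[m.+1]}).
Proof.
move=> k l /mpolyP/(_ U_(k)%MM)/eqP; rewrite !mcoeffX eqxx.
case: (U_(l)%MM =P U_(k)%MM) => [/mnmP/(_ k)|_]; last by rewrite oner_eq0.
by rewrite !mnm1E eqxx; case: eqP.
Qed.

Lemma subXU_neq0 k l : k != l -> 'X_k - 'X_l != 0 :> {mpoly R[m.+1]}.
Proof. by rewrite subr_eq0 (inj_eq mpolyXU_inj). Qed.

Lemma lo_neq_hi i : lo i != hi i.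
Proof. by rewrite -val_eqE /= ltn_eqF. Qed.

(** The definition with its denominator cleared. Over a domain this determines [piop] ([piop_uniq]),
    so identities between the operators are proved by cancelling differences of variables. *)
Lemma piop_mulE i f :
  ('X_(lo i) - 'X_(hi i)) * piop i f
    = (1 - 'X_(hi i)) * f - (1 - 'X_(lo i)) * msym (sadj i) f.
Proof.
rewrite /piop mulrDr mulrCA ddiffP.
by move: 'X_(lo i) 'X_(hi i) (msym _ _) => *; ring.
Qed.

Lemma piop_uniq i f g :
  ('X_(lo i) - 'X_(hi i)) * g
    = (1 - 'X_(hi i)) * f - (1 - 'X_(lo i)) * msym (sadj i) f ->
  piop i f = g.
Proof.
rewrite -piop_mulE => eq_g.
by apply/esym/(mulfI (subXU_neq0 (lo_neq_hi i)) eq_g).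
Qed.

Lemma piop_is_zmod_morphism i : zmod_morphism (@piop m R i).
Proof.
move=> f g; apply: piop_uniq.
rewrite msymB; move: (piop_mulE i f) (piop_mulE i g).
move: 'X_(lo i) 'X_(hi i) (msym _ f) (msym _ g) (piop i f) (piop i g).
by move=> a b f' g' p q eq_p eq_q; rewrite mulrBr eq_p eq_q; ring.
Qed.

HB.instance Definition _ i :=
  GRing.isZmodMorphism.Build _ _ (@piop m R i) (piop_is_zmod_morphism i).

(** In [piop_mulE] both the right-hand side and the factor x_i - x_(i+1) change sign under s_i. *)
Lemma msym_piop i f : msym (sadj i) (piop i f) = piop i f.
Proof.
apply: (mulfI (subXU_neq0 (lo_neq_hi i))).
move: (piop_mulE i f) (congr1 (msym (sadj i)) (piop_mulE i f)).
rewrite msymB !msymM !msymB !msymXU msym1 sadj_lo sadj_hi -msymMm sadjK msym1m.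
move: 'X_(lo i) 'X_(hi i) (msym _ f) (piop i f) (msym _ (piop i f)).
move=> a b f' p p' eq_p eq_p'; rewrite eq_p -(opprB b a) mulNr eq_p'.
by ring.
Qed.

Lemma piop_sym_mul i f g : msym (sadj i) g = g -> piop i (g * f) = g * piop i f.
Proof.
move=> sym_g; apply: piop_uniq; rewrite msymM sym_g; move: (piop_mulE i f).
move: 'X_(lo i) 'X_(hi i) (msym _ f) (piop i f) => a b f' p eq_p.
by rewrite mulrCA eq_p; ring.
Qed.

Lemma msym_notin i k : k != lo i -> k != hi i ->
  msym (sadj i) ('X_k : {mpoly R[m.+1]}) = 'X_k.
Proof. by move=> ne_lo ne_hi; rewrite msymXU /sadj tpermD // eq_sym. Qed.

Lemma piop_comm i j f : (i.+1 < j)%N -> piop i (piop j f) = piop j (piop i f).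
Proof.
move=> lt_ij.
have ne k l : (k \in [:: lo i; hi i]) -> (l \in [:: lo j; hi j]) -> k != l.
  rewrite !inE => /orP[]/eqP-> /orP[]/eqP->; rewrite -val_eqE /= /bump /=; lia.
have [sXj sXj'] : msym (sadj i) ('X_(lo j) : {mpoly R[m.+1]}) = 'X_(lo j) /\
    msym (sadj i) ('X_(hi j) : {mpoly R[m.+1]}) = 'X_(hi j).
  by split; apply: msym_notin; rewrite eq_sym ne // !inE eqxx ?orbT.
have [sXi sXi'] : msym (sadj j) ('X_(lo i) : {mpoly R[m.+1]}) = 'X_(lo i) /\
    msym (sadj j) ('X_(hi i) : {mpoly R[m.+1]}) = 'X_(hi i).
  by split; apply: msym_notin; rewrite ne // !inE eqxx ?orbT.
(* With both denominators cleared, the two sides are the same combination of the four images of f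
   under s_i and s_j. *)
apply: piop_uniq; apply: (mulfI (subXU_neq0 (lo_neq_hi j))).
have eq_sij : msym (sadj i) (msym (sadj j) f) = msym (sadj j) (msym (sadj i) f).
  by rewrite -!msymMm (sadj_comm lt_ij).
move: (piop_mulE j f) (piop_mulE i f) (piop_mulE j (piop i f)).
move: (congr1 (msym (sadj i)) (piop_mulE j f)).
move: (congr1 (msym (sadj j)) (piop_mulE i f)).
rewrite !(msymB, msymM, msym1) sXj sXj' sXi sXi' eq_sij.
move: 'X_(lo i) 'X_(hi i) 'X_(lo j) 'X_(hi j) => a b c d.
move: (msym (sadj i) (piop j f)) (msym (sadj j) (piop i f)).
move: (piop j (piop i f)) => p; move: (piop i f) (piop j f).
move: (msym (sadj j) (msym _ f)) => fij; move: (msym _ f) (msym _ f).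
move=> fi fj gi gj hj hi e1 e2 e3 e4 e5; rewrite [LHS]mulrCA e5.
transitivity ((1 - d) * ((a - b) * gi) - (1 - c) * ((a - b) * hi)); first by ring.
rewrite e1 e4.
transitivity ((1 - b) * ((c - d) * gj) - (1 - a) * ((c - d) * hj)); last by ring.
by rewrite e2 e3; ring.
Qed.


(* After multiplication by (a - b)(a - c)(b - c), both sides become the same   *)
(* combination of the six images of f under permutations of a, b, c.           *)
Lemma piop_braid i j f : j = i.+1 :> nat ->
  piop i (piop j (piop i f)) = piop j (piop i (piop j f)).
Proof.
move=> eq_j; have hi_i : hi i = lo j by apply: val_inj; rewrite /= eq_j.
have ne_ac : lo i != hi j by apply/eqP => /(congr1 val); rewrite /= /bump /= eq_j; lia.
have sXc : msym (sadj i) ('X_(hi j) : {mpoly R[m.+1]}) = 'X_(hi j).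
  by apply: msym_notin; rewrite 1?eq_sym // hi_i lo_neq_hi.
have sXa : msym (sadj j) ('X_(lo i) : {mpoly R[m.+1]}) = 'X_(lo i).
  by apply: msym_notin; rewrite -?hi_i ?lo_neq_hi.
have sXb : msym (sadj i) ('X_(lo j) : {mpoly R[m.+1]}) = 'X_(lo i).
  by rewrite msymXU -hi_i sadj_hi.
have sXa' : msym (sadj i) ('X_(lo i) : {mpoly R[m.+1]}) = 'X_(lo j).
  by rewrite msymXU sadj_lo hi_i.
have sXb' : msym (sadj j) ('X_(lo j) : {mpoly R[m.+1]}) = 'X_(hi j).
  by rewrite msymXU sadj_lo.
have sXc' : msym (sadj j) ('X_(hi j) : {mpoly R[m.+1]}) = 'X_(lo j).
  by rewrite msymXU sadj_hi.
have msymE := (sXc, sXa, sXb, sXa', sXb', sXc').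
have eq_f0 : msym (sadj j) (msym (sadj i) (msym (sadj j) f))
    = msym (sadj i) (msym (sadj j) (msym (sadj i) f)).
  by rewrite -!msymMm !mulgA (sadj_braid eq_j).
apply: (mulfI (subXU_neq0 (lo_neq_hi i))); rewrite hi_i.
apply: (mulfI (subXU_neq0 ne_ac)); apply: (mulfI (subXU_neq0 (lo_neq_hi j))).
(* Naming the six nested polynomials leaves an identity in a commutative ring that follows from
   their defining equations and the images of these under s_i and s_j. *)
suff eq_k g h k g' h' k' : piop i f = g -> piop j g = h -> piop i h = k ->
    piop j f = g' -> piop i g' = h' -> piop j h' = k' ->
    ('X_(lo j) - 'X_(hi j)) * (('X_(lo i) - 'X_(hi j))
      * (('X_(lo i) - 'X_(lo j)) * k)) =
    ('X_(lo j) - 'X_(hi j)) * (('X_(lo i) - 'X_(hi j))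
      * (('X_(lo i) - 'X_(lo j)) * k')).
  by apply: (eq_k _ _ _ _ _ _ erefl erefl erefl erefl erefl erefl).
move=> def_g def_h def_k def_g' def_h' def_k'.
have sg : msym (sadj i) g = g by rewrite -def_g msym_piop.
have sg' : msym (sadj j) g' = g' by rewrite -def_g' msym_piop.
have e1 := piop_mulE i f; rewrite hi_i def_g in e1.
have e2 := congr1 (msym (sadj j)) e1.
rewrite msymB !msymM !msymB !msym1 !msymE in e2.
have e3 := congr1 (msym (sadj i)) e2.
rewrite msymB !msymM !msymB !msym1 !msymE in e3.
have e4 := piop_mulE j g; rewrite def_h in e4.
have e5 := congr1 (msym (sadj i)) e4.
rewrite msymB !msymM !msymB !msym1 !msymE sg in e5.
have e6 := piop_mulE i h; rewrite hi_i def_k in e6.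
have e1' := piop_mulE j f; rewrite def_g' in e1'.
have e2' := congr1 (msym (sadj i)) e1'.
rewrite msymB !msymM !msymB !msym1 !msymE in e2'.
have e3' := congr1 (msym (sadj j)) e2'.
rewrite msymB !msymM !msymB !msym1 !msymE eq_f0 in e3'.
have e4' := piop_mulE i g'; rewrite hi_i def_h' in e4'.
have e5' := congr1 (msym (sadj j)) e4'.
rewrite msymB !msymM !msymB !msym1 !msymE sg' in e5'.
have e6' := piop_mulE j h'; rewrite def_k' in e6'.
clear - e1 e2 e3 e4 e5 e6 e1' e2' e3' e4' e5' e6'.
move: 'X_(lo i) 'X_(lo j) 'X_(hi j) (msym (sadj i) h) (msym (sadj j) h')
  e1 e2 e3 e4 e5 e6 e1' e2' e3' e4' e5' e6'.
move: (msym (sadj i) (msym (sadj j) g)) (msym (sadj j) (msym (sadj i) g')).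
move: (msym (sadj j) g) (msym (sadj i) g') => sg sg' ssg ssg'.
move: (msym (sadj i) (msym (sadj j) (msym (sadj i) f))) => fw.
move: (msym (sadj i) (msym (sadj j) f)) (msym (sadj j) (msym (sadj i) f)).
move: (msym (sadj i) f) (msym (sadj j) f) => fi fj fij fji.
move=> a b c sh sh' e1 e2 e3 e4 e5 e6 e1' e2' e3' e4' e5' e6'.
transitivity ((1 - b) * (a - c) * ((b - c) * h)
  - (1 - a) * (b - c) * ((a - c) * sh)); first by rewrite e6; ring.
transitivity ((1 - c) * (a - c) * ((a - b) * h')
  - (1 - b) * (a - b) * ((a - c) * sh')); last first.
  transitivity ((a - b) * (a - c) * ((b - c) * k')); last by ring.
  by rewrite e6'; ring.
rewrite e4 e5 e4' e5'.
transitivity ((1 - c) ^+ 2 * ((a - b) * g) - (1 - b) ^+ 2 * ((a - c) * sg)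
  + (1 - a) ^+ 2 * ((b - c) * ssg)); first by ring.
transitivity ((1 - b) * (1 - c) * ((b - c) * g')
  - (1 - c) * (1 - a) * ((a - c) * sg')
  + (1 - b) * (1 - a) * ((a - b) * ssg')); last by ring.
by rewrite e1 e2 e3 e1' e2' e3'; ring.
Qed.


End Piop.

(** The operator only permutes and multiplies by outer variables, so it ignores what an additive map
    does to the coefficients. With [phi] an operator in y, this is the commutation of the two
    families. *)
Lemma map_piop m (R S : idomainType) (phi : {additive R -> S}) (i : 'I_m)
    (f : {mpoly R[m.+1]}) :
  map_mpoly phi (piop i f) = piop i (map_mpoly phi f).
Proof.
apply/esym/piop_uniq; have := congr1 (map_mpoly phi) (piop_mulE i f).
by rewrite !mulrBl !mul1r !raddfB /= !map_mpolyXM map_msym.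
Qed.

(** * The kernel *)

(** After the exchange, the variables set to zero are the outer variables of [f], and its
    coefficients are polynomials in x. *)
Lemma y_zero_swap_xy m (f : Zqxy m) : y_zero (swap_xy f) = f@_0.
Proof.
have yD (g h : Zqxy m) : y_zero (g + h) = y_zero g + y_zero h.
  exact: (raddfD (map_mpoly (@meval m.+1 (Zq m) (fun _ => 0)))).
have yM (g h : Zqxy m) : y_zero (g * h) = y_zero g * y_zero h.
  exact: (rmorphM (map_mpoly (@meval m.+1 (Zq m) (fun _ => 0)))).
elim/mpolyind: f => [|c mo f _ _ IHf].
  by rewrite mcoeff0 /swap_xy mmap0 /y_zero raddf0.
rewrite mcoeffD mcoeffZ mcoeffX -IHf /swap_xy mmapD mmapZ mmapX yD yM.
congr (_ * _ + _).
  by apply/mpolyP=> mo'; rewrite !mcoeff_map_mpoly /= mevalC.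
rewrite /y_zero /mmap1 rmorph_prod /=.
have y0 k : map_mpoly (@meval m.+1 (Zq m) (fun _ => 0)) ('X_k)%:MP_[m.+1] = 0.
  by rewrite map_mpolyC /= mevalXU mpolyC0.
case: (mo =P 0%MM) => [->|/eqP].
  by rewrite big1 // => i _; rewrite mnm0E expr0 rmorph1.
rewrite -mdeg_eq0 mdegE sum_nat_eq0 => /forallPn[k]; rewrite implyTb => nz_k.
by rewrite (bigD1 k) //= rmorphXn /= y0 expr0n (negbTE nz_k) mul0r.
Qed.

Lemma msymC n (R : nzRingType) (s : 'S_n) (c : R) :
  msym s (c%:MP : {mpoly R[n]}) = c%:MP.
Proof. by rewrite [LHS]mmapC. Qed.

Section Kernel.

Variables (m : nat) (R : idomainType).

Definition kernel_factor (p : 'I_m.+1 * 'I_m.+1) :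
    {mpoly {mpoly R[m.+1]}[m.+1]} :=
  'X_p.1 + ('X_p.2)%:MP - 'X_p.1 * ('X_p.2)%:MP.

(* The double Grothendieck polynomial of the longest element at q = 0. *)
Definition kernel : {mpoly {mpoly R[m.+1]}[m.+1]} :=
  \prod_(p : 'I_m.+1 * 'I_m.+1 | (p.1 + p.2 < m)%N) kernel_factor p.

Lemma msym_kernel_factor s p :
  msym s (kernel_factor p) = kernel_factor (s p.1, p.2).
Proof. by rewrite /kernel_factor msymB msymM msymD !msymXU msymC. Qed.

Lemma map_msym_kernel_factor s p :
  map_mpoly (msym s) (kernel_factor p) = kernel_factor (p.1, s p.2).
Proof.
rewrite /kernel_factor (rmorphB (map_mpoly (msym s))) /=.
rewrite (rmorphM (map_mpoly (msym s))) (rmorphD (map_mpoly (msym s))) /=.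
by rewrite !map_mpolyX !map_mpolyC /= msymXU.
Qed.

Lemma mcoeff0_kernel_factor p : (kernel_factor p)@_0 = 'X_p.2.
Proof.
rewrite /kernel_factor [_ * _%:MP]mulrC mul_mpolyC mcoeffB mcoeffD mcoeffZ.
by rewrite mcoeffC !mcoeffX -!mdeg_eq0 mdeg0 mdeg1 mulr0 subr0 mulr1 add0r.
Qed.

Definition kernel_but q : {mpoly {mpoly R[m.+1]}[m.+1]} :=
  \prod_(p : 'I_m.+1 * 'I_m.+1 | (p.1 + p.2 < m)%N && (p != q)) kernel_factor p.

Lemma kernelD1 i :
  kernel = kernel_factor (lo i, lo (rev_ord i))
             * kernel_but (lo i, lo (rev_ord i)).
Proof. by rewrite /kernel (bigD1 (lo i, lo (rev_ord i))) //=; have := ltn_ord i; lia. Qed.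

(** The removed cell is the last one of row i in the staircase a + b < m. Without it, rows i and i+1
    have the same length, so s_i permutes the remaining factors. *)
Lemma msym_kernel_but i : let q := (lo i, lo (rev_ord i)) in
  msym (sadj i) (kernel_but q) = kernel_but q.
Proof.
rewrite /kernel_but rmorph_prod /=; set q := (_, _).
pose h (p : 'I_m.+1 * 'I_m.+1) := (sadj i p.1, p.2).
have hK : involutive h by case=> a b; rewrite /h /= /sadj tpermK.
rewrite [RHS](reindex_inj (inv_inj hK)) /=; apply: eq_big => [[a b]|[a b] _].
  rewrite /h /q !xpair_eqE -!val_eqE /= !sadjE /=.
  by have := ltn_ord i; repeat case: eqP; lia.
by rewrite msym_kernel_factor.
Qed.

(** The operator is linear over s_i-invariants and sends x_i + y - x_i y = 1 - (1 - x_i)(1 - y) to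
    1, as it fixes 1 and kills 1 - x_i. *)
Lemma piop_kernel i : piop i kernel = kernel_but (lo i, lo (rev_ord i)).
Proof.
rewrite (kernelD1 i) mulrC piop_sym_mul ?msym_kernel_but //.
rewrite -[RHS]mulr1; congr (_ * _); apply: piop_uniq.
rewrite msym_kernel_factor /kernel_factor /= sadj_lo.
by move: 'X_(lo i) 'X_(hi i) ('X_(lo (rev_ord i)))%:MP => *; ring.
Qed.

Lemma map_msym_kernel_but j : let q := (lo (rev_ord j), lo j) in
  map_mpoly (msym (sadj j)) (kernel_but q) = kernel_but q.
Proof.
rewrite /kernel_but rmorph_prod /=; set q := (_, _).
pose h (p : 'I_m.+1 * 'I_m.+1) := (p.1, sadj j p.2).
have hK : involutive h by case=> a b; rewrite /h /= /sadj tpermK.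
rewrite [RHS](reindex_inj (inv_inj hK)) /=; apply: eq_big => [[a b]|[a b] _].
  rewrite /h /q !xpair_eqE -!val_eqE /= !sadjE /=.
  by have := ltn_ord j; repeat case: eqP; lia.
by rewrite map_msym_kernel_factor.
Qed.

Lemma map_piop_mulE (j : 'I_m) (f : {mpoly {mpoly R[m.+1]}[m.+1]}) :
  ('X_(lo j) - 'X_(hi j))%:MP * map_mpoly (@piop m R j) f
    = (1 - 'X_(hi j))%:MP * f - (1 - 'X_(lo j))%:MP * map_mpoly (msym (sadj j)) f.
Proof.
apply/mpolyP=> mo.
rewrite [LHS]mcoeffCM [RHS]mcoeffB (mcoeffCM _ f) (mcoeffCM _ (map_mpoly _ f)).
rewrite [in LHS](mcoeff_map_mpoly (@piop m R j)).
rewrite [in RHS](mcoeff_map_mpoly (msym (sadj j))).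
exact: piop_mulE.
Qed.

Lemma map_piop_kernel j :
  map_mpoly (@piop m R j) kernel = kernel_but (lo (rev_ord j), lo j).
Proof.
have := kernelD1 (rev_ord j); rewrite rev_ordK => def_k.
have nz : ('X_(lo j) - 'X_(hi j))%:MP != 0 :> {mpoly {mpoly R[m.+1]}[m.+1]}.
  by rewrite mpolyC_eq0 subXU_neq0 ?lo_neq_hi.
apply: (mulfI nz); rewrite map_piop_mulE def_k rmorphM /= map_msym_kernel_but.
rewrite map_msym_kernel_factor /= sadj_lo /kernel_factor /= !mpolyCB !mpolyC1.
move: (kernel_but _) ('X_(lo j))%:MP ('X_(hi j))%:MP 'X_(lo (rev_ord j)).
by move=> *; ring.
Qed.

(** The first letter of [s] acts last in x. Moved through the y operators, it reaches the kernel and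
    becomes a y operator that acts first: hence the reversal. *)
Lemma foldr_piop_kernel s :
  foldr (@piop m _) kernel s
    = foldr (fun j => map_mpoly (@piop m R j)) kernel (rev (map (@rev_ord m) s)).
Proof.
elim: s => //= i s ->; rewrite rev_cons foldr_rcons map_piop_kernel rev_ordK.
rewrite -piop_kernel.
by elim: (rev _) => //= j t <-; rewrite map_piop.
Qed.

(** The y operators act coefficientwise, so the constant term in x can be taken first; there the
    factor at (a, b) becomes y_b, and column b of the staircase has m - b cells. *)
Lemma mcoeff0_piops s :
  (foldr (@piop m _) kernel s)@_0
    = foldr (@piop m R) (\prod_(i < m) 'X_(lo i) ^+ (m - i)) (rev (map (@rev_ord m) s)).
Proof.
rewrite foldr_piop_kernel; elim: (rev _) => /= [|i t <-]; last first.
  by rewrite mcoeff_map_mpoly.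
rewrite /kernel rmorph_prod /=.
under eq_bigr => p _ do rewrite mcoeff0_kernel_factor.
rewrite -(pair_big_dep xpredT (fun a b : 'I_m.+1 => (a + b < m)%N) (fun _ b => 'X_b)) /=.
rewrite (exchange_big_dep xpredT) //= big_ord_recr /= [X in _ * X]big1 ?mulr1.
  apply: eq_bigr => i _; rewrite prodr_const; congr (_ ^+ _).
  rewrite -sum1_card -[RHS]card_ord -sum1_card (big_ord_widen m.+1 (fun=> 1%N)).
    by apply: eq_bigl => a; rewrite unfold_in -[LHS]/(a + i < m)%N; lia.
  by lia.
by move=> a; rewrite /= -[X in (X < _)%N]/(a + m)%N; lia.
Qed.

Lemma kernel_prod : kernel = \prod_(i < m) \prod_(j < i.+1)
  ('X_(lo (rev_ord i)) + (1 - 'X_(lo (rev_ord i))) * ('X_(inord j))%:MP).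
Proof.
rewrite /kernel -(pair_big_dep xpredT (fun a b : 'I_m.+1 => (a + b < m)%N)
  (fun a b => kernel_factor (a, b))) /=.
rewrite big_ord_recr /= [X in _ * X]big1 ?mulr1; last first.
  by move=> b; rewrite -[X in (X < _)%N]/(m + b)%N; lia.
rewrite (reindex_inj rev_ord_inj) /=; apply: eq_bigr => i _.
rewrite -/(lo (rev_ord i)) (big_ord_widen m.+1 (fun j =>
  'X_(lo (rev_ord i)) + (1 - 'X_(lo (rev_ord i))) * ('X_(inord j))%:MP)).
  apply: eq_big => [b|b _]; first by have := ltn_ord i; lia.
  by rewrite inord_val /kernel_factor /=; move: 'X_(lo _) ('X_b)%:MP => *; ring.
by rewrite ltnS ltnW.
Qed.

End Kernel.

(** * Reversed words and the longest element *)

Lemma w0K m : (w0 m * w0 m = 1)%g.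
Proof. by apply/permP=> a; rewrite permM !permE rev_ordK. Qed.

Lemma w0V m : ((w0 m)^-1 = w0 m)%g.
Proof. by rewrite -[RHS]mul1g -(mulVg (w0 m)) -mulgA w0K mulg1. Qed.

Lemma sadj_rev m (i : 'I_m) : sadj (rev_ord i) = (w0 m * sadj i * w0 m)%g.
Proof.
rewrite -{1}w0V -mulgA -[RHS]/(_ ^ _)%g /sadj tpermJ tpermC.
by congr tperm; apply: val_inj; rewrite /= permE /= /bump /=; have := ltn_ord i; lia.
Qed.

Lemma word_perm_rev m (s : seq 'I_m) :
  word_perm (rev (map (@rev_ord m) s)) = (w0 m * (word_perm s)^-1 * w0 m)%g.
Proof.
elim: s => [|i s IHs]; first by rewrite /= invg1 mulg1 w0K.
rewrite word_permV_cons /= rev_cons -cats1 word_perm_cat IHs /permcomp /=.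
by rewrite /permcomp mul1g sadj_rev !mulgA -[X in (X * _ * _)%g]mulgA w0K mulg1.
Qed.

Lemma reduced_for_rev m (u : 'S_m.+1) s : reduced_for u s ->
  reduced_for (w0 m * u^-1 * w0 m)%g (rev (map (@rev_ord m) s)).
Proof.
case/andP=> /eqP def_u /forallP min_s; rewrite /reduced_for word_perm_rev def_u eqxx.
apply/forallP=> l; apply/forallP=> t; apply/eqP => def_t.
have lt_l : (l < size s)%N.
  by have := ltn_ord l; rewrite [X in (_ < X)%N]size_rev size_map.
have /forallP/(_ [tuple of rev (map (@rev_ord m) t)])/eqP[] := min_s (Ordinal lt_l).
rewrite /= word_perm_rev def_t !invMg invgK w0V !mulgA w0K mul1g.
by rewrite -mulgA w0K mulg1.
Qed.

Lemma eq_reduced_piop m (R : idomainType) (u : 'S_m.+1) s t (f : {mpoly R[m.+1]}) :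
  reduced_for u s -> reduced_for u t ->
  foldr (@piop m R) f s = foldr (@piop m R) f t.
Proof.
move=> red_s red_t; apply: eq_reduced_op.
- by move=> i j x; apply: piop_comm.
- by move=> i j x; apply: piop_braid.
- exact: reduced_size red_s.
- exact: reduced_size red_t.
by case/andP: red_s => /eqP-> _; case/andP: red_t => /eqP-> _.
Qed.

(** For u = w w_0, the reversed and reflected word represents w_0 u^-1 w_0 = w^-1 w_0. It need not
    be the word chosen by [piperm], whence [eq_reduced_piop]. *)
Lemma piperm_kernel m (R : idomainType) (w : 'S_m.+1) :
  (piperm (permcomp w (w0 m)) (kernel m R))@_0
    = piperm (permcomp w^-1%g (w0 m)) (\prod_(i < m) 'X_(lo i) ^+ (m - i)).
Proof.
rewrite [LHS]mcoeff0_piops; apply: (eq_reduced_piop _ _ (xchooseP (reduced_for_ex _))).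
have := reduced_for_rev (xchooseP (reduced_for_ex (permcomp w (w0 m)))).
by rewrite {2}/permcomp invMg w0V -!mulgA w0K mulg1.
Qed.

Lemma map_piperm m (R S : idomainType) (phi : {additive R -> S}) (u : 'S_m.+1) f :
  map_mpoly phi (piperm u f) = piperm u (map_mpoly phi f).
Proof. by rewrite /piperm; elim: (reduced_word u) => //= i s <-; rewrite map_piop. Qed.

(** Computes [phi] on a Grothendieck polynomial from its effect on the kernel alone. Used for
    [Lq_proj] and for [quantize]. *)
Lemma additive_piperm m (R : idomainType)
    (phi : {additive {mpoly R[m.+1]} -> {mpoly R[m.+1]}}) (w : 'S_m.+1) g :
  map_mpoly phi (kernel m R) = g ->
  phi (piperm (permcomp w^-1%g (w0 m)) (\prod_(i < m) 'X_(lo i) ^+ (m - i)))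
    = (piperm (permcomp w (w0 m)) g)@_0.
Proof. by move <-; rewrite -map_piperm mcoeff_map_mpoly piperm_kernel. Qed.

(** * Elementary symmetric polynomials and staircase monomials *)

Lemma prod_addM_sum (A : comNzRingType) k (y : 'I_k -> A) (x z : A) :
  \prod_(j < k) (x + z * y j) = \sum_(p < k.+1) x ^+ (k - p) * z ^+ p *
    \sum_(h : {set 'I_k} | #|h| == p) \prod_(j in h) y j.
Proof.
under eq_bigr => j _ do rewrite addrC.
rewrite bigA_distr (partition_big (fun h : {set 'I_k} => inord #|h| : 'I_k.+1) xpredT) //=.
apply: eq_bigr => p _; rewrite big_distrr /=; apply: eq_big => [h|h /eqP <-].
  by rewrite -val_eqE /= inordK // ltnS -[k in X in (_ <= X)%N]card_ord max_card.
have le_h : (#|h| <= k)%N by rewrite -[k in X in (_ <= X)%N]card_ord max_card.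
rewrite inordK ?ltnS //.
rewrite (bigID (mem h)) /= mulrC.
rewrite (eq_bigr (fun _ => x)) => [|j /negbTE-> //].
rewrite [X in _ * X](eq_bigr (fun j => z * y j)) => [|j -> //].
rewrite big_split /= !prodr_const mulrA; congr (_ ^+ _ * _ * _).
apply/eqP; rewrite -(eqn_add2l #|h|) subnKC // -[X in _ == X]card_ord -(cardC (mem h)).
by rewrite eqxx.
Qed.

Section Esym.

Variable A : comNzRingType.
Implicit Types x : nat -> A.

(** Taking a sequence [x] allows the first variable to be dropped by a shift; the generating
    function makes the recursion [elem_sym_recl] immediate. *)
Definition elem_sym x k p : A := (\prod_(j < k) (1 + 'X * (x j)%:P))`_p.

Lemma elem_symE x k p :
  elem_sym x k p = \sum_(h : {set 'I_k} | #|h| == p) \prod_(j in h) x j.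
Proof.
rewrite /elem_sym (prod_addM_sum (fun j : 'I_k => (x j)%:P)) coef_sum.
have eq_c (q : 'I_k.+1) : (1 ^+ (k - q) * 'X ^+ q *
    \sum_(h : {set 'I_k} | #|h| == q) \prod_(j in h) (x j)%:P)`_p
  = (p == q)%:R * \sum_(h : {set 'I_k} | #|h| == p) \prod_(j in h) x j.
  rewrite expr1n mul1r.
  under eq_bigr => h _ do rewrite -rmorph_prod /=.
  rewrite -rmorph_sum /= mulrC coefCM coefXn mulrC.
  by case: eqP => [->|_]; rewrite ?mul0r.
under eq_bigr => q _ do rewrite eq_c.
rewrite -big_distrl /=; have [le_pk|lt_kp] := leqP p k.
  rewrite (bigD1 (inord p)) //= inordK // eqxx big1 ?addr0 ?mul1r // => q.
  by rewrite -val_eqE /= inordK // eq_sym => /negbTE->.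
rewrite [RHS]big1 ?[X in _ * X]big1 ?mulr0 // => h /eqP card_h;
  by have := max_card (mem h); rewrite card_h card_ord leqNgt lt_kp.
Qed.

Lemma prod_addM_elem_sym (B : comNzRingType) (c : {rmorphism A -> B})
    (y : nat -> A) k (x z : B) :
  \prod_(j < k) (x + z * c (y j))
    = \sum_(p < k.+1) x ^+ (k - p) * z ^+ p * c (elem_sym y k p).
Proof.
rewrite (prod_addM_sum (fun j : 'I_k => c (y j))); apply: eq_bigr => p _.
rewrite elem_symE rmorph_sum; congr (_ * _); apply: eq_bigr => h _.
by rewrite rmorph_prod.
Qed.

Lemma elem_sym0 x k : elem_sym x k 0 = 1.
Proof.
rewrite /elem_sym coef0_prod big1 // => j _.
by rewrite coefD coef1 coefXM eqxx addr0.
Qed.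

Lemma elem_sym_recl x k p :
  elem_sym x k.+1 p.+1 = elem_sym (x \o succn) k p.+1 + x 0%N * elem_sym (x \o succn) k p.
Proof.
rewrite /elem_sym big_ord_recl mulrDl mul1r -mulrA coefD coefXM coefCM /=.
by [].
Qed.

Lemma elem_sym_big x k p : (k < p)%N -> elem_sym x k p = 0.
Proof.
elim: k x p => [|k IHk] x [|p] // lt_kp.
  by rewrite /elem_sym big_ord0 coef1.
by rewrite elem_sym_recl !IHk ?mulr0 ?addr0 // ltnW.
Qed.

Definition zclosed (P : A -> Prop) :=
  [/\ P 0, forall f, P f -> P (- f) & forall f g, P f -> P g -> P (f + g)].

Lemma zclosedB P f g : zclosed P -> P f -> P g -> P (f - g).
Proof. by case=> _ PN PD Pf Pg; apply: PD => //; apply: PN. Qed.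

(** Write e' for the functions without x_0. The recursion e_(p+1) = e'_(p+1) + x_0 e'_p is solved in
    either direction with a + p constant: for a + p <= k it lowers p down to e'_0 = 1; otherwise it
    raises p up to e'_(k+1) = 0. *)
Lemma elem_sym_shift_span x k (P : A -> Prop) : zclosed P ->
  (forall a p, (a <= k)%N -> (p <= k.+1)%N -> P (x 0%N ^+ a * elem_sym x k.+1 p)) ->
  forall a p, (a <= k.+1)%N -> (p <= k)%N ->
    P (x 0%N ^+ a * elem_sym (x \o succn) k p).
Proof.
move=> clP genP a p le_a le_p; have [P0 _ _] := clP.
have [le_ap|lt_ap] := leqP (a + p) k.
  elim: p a le_a le_p le_ap => [|p IHp] a le_a le_p le_ap.
    have := genP a 0%N; rewrite !elem_sym0; apply; lia.
  have -> : x 0%N ^+ a * elem_sym (x \o succn) k p.+1 =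
    x 0%N ^+ a * elem_sym x k.+1 p.+1 - x 0%N ^+ a.+1 * elem_sym (x \o succn) k p.
    by rewrite elem_sym_recl exprSr; ring.
  by apply: zclosedB => //; [apply: genP; lia|apply: IHp; lia].
have [r] := ubnP (k - p)%N; elim: r a p le_a le_p lt_ap => // r IHr [|a] p; first by lia.
move=> le_a le_p lt_ap lt_r.
have -> : x 0%N ^+ a.+1 * elem_sym (x \o succn) k p =
  x 0%N ^+ a * elem_sym x k.+1 p.+1 - x 0%N ^+ a * elem_sym (x \o succn) k p.+1.
  by rewrite elem_sym_recl exprSr; ring.
apply: zclosedB => //; first by apply: genP; lia.
have [->|ne_pk] := eqVneq p k; first by rewrite elem_sym_big ?mulr0.
by apply: IHr; lia.
Qed.

(* Eliminates the variables one at a time, starting with the first one: by     *)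
(* the previous lemma the powers of x_0 up to l + 1 absorb the change from     *)
(* symmetric functions of x_1, ..., x_l to those of x_0, ..., x_l.             *)
Lemma staircase_span d x (P : A -> Prop) : zclosed P ->
  (forall p : nat -> nat, (forall k, (p k <= k.+1)%N) ->
     P (\prod_(k < d) elem_sym x k.+1 (p k))) ->
  forall a : nat -> nat, (forall j, (a j <= d - j)%N) ->
     P (\prod_(j < d) x j ^+ a j).
Proof.
elim: d x P => [|d IHd] x P clP genP a le_a.
  by have := genP (fun=> 0%N) (fun=> isT); rewrite !big_ord0.
rewrite big_ord_recl /=.
pose P' f := forall b, (b <= d.+1)%N -> P (x 0%N ^+ b * f).
have [P0 PN PD] := clP.
suff: P' (\prod_(j < d) (x \o succn) j ^+ (a \o succn) j).
  by apply; rewrite (leq_trans (le_a 0%N)) // subn0.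
apply: IHd => [|p le_p|j]; last by rewrite /= -subSS.
  split=> [b _|f Pf b le_b|f g Pf Pg b le_b]; rewrite ?mulr0 ?mulrN ?mulrDr //.
    by apply: PN; apply: Pf.
  by apply: PD; [apply: Pf|apply: Pg].
move=> b le_b.
(* Interpolates between the goal (l = d, all functions shifted) and the hypothesis (l = 0, where
   x_0^c is e_c of the single variable x_0). *)
suff gen l q c : (l <= d)%N -> (forall k, (q k <= k.+1)%N) -> (c <= l.+1)%N ->
    P (x 0%N ^+ c * \prod_(k < l) elem_sym (x \o succn) k.+1 (p k)
       * \prod_(l.+1 <= k < d.+1) elem_sym x k.+1 (q k)).
  have := gen d (fun=> 0%N) b (leqnn d) (fun=> isT) le_b.
  by rewrite big_geq // mulr1.
elim: l q c => [|l IHl] q c le_l le_q le_c.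
  rewrite big_ord0 mulr1.
  have -> : x 0%N ^+ c = elem_sym x 1 c.
    case: c le_c => [|[|//]] _; rewrite ?elem_sym0 // elem_sym_recl elem_sym0 mulr1.
    by rewrite elem_sym_big ?add0r.
  have := genP (fun k => if k == 0%N then c else q k).
  rewrite -(big_mkord xpredT (fun k => elem_sym x k.+1 (if k == 0%N then c else q k))).
  rewrite big_ltn //= => Pg.
  rewrite (eq_big_nat _ _ (F2 := fun k => elem_sym x k.+1 (if k == 0%N then c else q k))).
    apply: Pg => -[|k] /=; [exact: le_c|exact: le_q].
  by case.
pose V f := P (f * \prod_(k < l) elem_sym (x \o succn) k.+1 (p k)
  * \prod_(l.+2 <= k < d.+1) elem_sym x k.+1 (q k)).
suff: V (x 0%N ^+ c * elem_sym (x \o succn) l.+1 (p l)).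
  by rewrite /V big_ord_recr /= [X in _ -> P (_ * X * _)]mulrC mulrA.
apply: elem_sym_shift_span => //.
  split=> [|f Vf|f g Vf Vg]; rewrite /V ?mul0r ?mulNr ?mulrDl //.
    exact: PN.
  exact: PD.
move=> e r le_e le_r.
have := IHl (fun k => if k == l.+1 then r else q k) e (ltnW le_l) _ le_e.
rewrite big_ltn ?eqxx // mulrA [X in P (X * _)]mulrAC /V => Pg.
rewrite (eq_big_nat _ _ (F2 := fun k => elem_sym x k.+1 (if k == l.+1 then r else q k))).
  apply: Pg => k; case: eqP => [->|//].
  by [].
by move=> k /andP[lt_k _]; rewrite gtn_eqF.
Qed.

End Esym.

(** * The module L_n^q *)

Section DegreeIn.

Variables (n : nat) (R : comNzRingType) (j : 'I_n).
Implicit Types f g : {mpoly R[n]}.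

Definition degree_in (d : nat) f : Prop := forall mo, mo \in msupp f -> (mo j <= d)%N.

Lemma degree_in_le d1 d2 f : (d1 <= d2)%N -> degree_in d1 f -> degree_in d2 f.
Proof. by move=> le_d deg_f mo /deg_f/leq_trans->. Qed.

Lemma degree_in0 d : degree_in d 0.
Proof. by move=> mo; rewrite msupp0. Qed.

Lemma degree_inC d c : degree_in d c%:MP.
Proof.
by move=> mo; rewrite msuppC; case: eqP => // _; rewrite inE => /eqP->; rewrite mnm0E.
Qed.

Lemma degree_inX k : degree_in (k == j) 'X_k.
Proof. by move=> mo; rewrite msuppX inE => /eqP->; rewrite mnm1E. Qed.

Lemma degree_inD d f g : degree_in d f -> degree_in d g -> degree_in d (f + g).
Proof.
by move=> deg_f deg_g mo /msuppD_le; rewrite mem_cat => /orP[/deg_f|/deg_g].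
Qed.

Lemma degree_inN d f : degree_in d f -> degree_in d (- f).
Proof. by move=> deg_f mo; rewrite (perm_mem (msuppN f)) => /deg_f. Qed.

Lemma degree_inZ d c f : degree_in d f -> degree_in d (c *: f).
Proof. by move=> deg_f mo /msuppZ_le/deg_f. Qed.

Lemma degree_inM d1 d2 f g :
  degree_in d1 f -> degree_in d2 g -> degree_in (d1 + d2) (f * g).
Proof.
move=> deg_f deg_g mo /msuppM_le/allpairsP[[m1 m2] /= [/deg_f le1 /deg_g le2 ->]].
by rewrite mnmDE leq_add.
Qed.

Lemma degree_in_sum (I : Type) (r : seq I) (P : pred I) (F : I -> {mpoly R[n]}) d :
  (forall i, P i -> degree_in d (F i)) -> degree_in d (\sum_(i <- r | P i) F i).
Proof.
by move=> deg_F; elim/big_rec: _ => [|i f /deg_F]; [exact: degree_in0|exact: degree_inD].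
Qed.

Lemma degree_in_prod (I : Type) (r : seq I) (P : pred I) (F : I -> {mpoly R[n]}) d :
  (forall i, P i -> degree_in (d i) (F i)) ->
  degree_in (\sum_(i <- r | P i) d i) (\prod_(i <- r | P i) F i).
Proof.
move=> deg_F; elim/big_rec2: _ => [|i e f /deg_F deg_i deg_f].
  by rewrite -mpolyC1; apply: degree_inC.
exact: degree_inM.
Qed.

End DegreeIn.

Lemma big_ord_eq_le1 n (I : finType) (F : I -> 'I_n) (P : pred I) (j : 'I_n) (b : bool) :
  injective F -> (forall i, P i -> F i = j -> b) ->
  (\sum_(i | P i) (F i == j) <= b)%N.
Proof.
move=> inj_F Pb; case: (pickP (fun i => P i && (F i == j))) => [i /andP[Pi /eqP Fi]|F0].
  rewrite (Pb i Pi Fi) (bigD1 i) //= Fi eqxx big1 // => k /andP[_ ne_k].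
  by rewrite -Fi (inj_eq inj_F) (negbTE ne_k).
by rewrite big1 // => i Pi; have := F0 i; rewrite Pi /= => ->.
Qed.

Section Qhat.

Variable m : nat.

Let x k : Zqx m := 'X_(inord k).

Lemma elsymE p k : elsym m p k = elem_sym x k p.
Proof.
rewrite elem_symE /elsym /mesym rmorph_sum /=; apply: eq_bigr => h _.
rewrite rmorph_prod /=; apply: eq_bigr => i _.
by rewrite comp_mpolyXU -tnth_nth tnth_mktuple.
Qed.

Lemma degree_in_elsym p k (j : 'I_m.+1) : (k <= m)%N ->
  degree_in j (j < k)%N (elsym m p k).
Proof.
move=> le_km; rewrite elsymE elem_symE; apply: degree_in_sum => h _.
apply: (@degree_in_le _ _ _ (\sum_(i in h) (inord i == j :> 'I_m.+1))%N).
  apply: (@big_ord_eq_le1 _ _ (fun i : 'I_k => inord i)) => [i1 i2|i _ <-].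
    move=> /(congr1 val) /=; have := ltn_ord i1; have := ltn_ord i2.
    by move=> lt1 lt2; rewrite !inordK; [move=> /val_inj|lia|lia].
  by have lt_i := ltn_ord i; rewrite inordK; lia.
by apply: degree_in_prod => i _; apply: degree_inX.
Qed.

Lemma degree_in_Fq p k (j : 'I_m.+1) : degree_in j (j < k)%N (Fq m p k).
Proof.
apply: degree_in_sum => I /andP[_ /forall_inP lt_k].
rewrite -[X in degree_in _ X _]addn0; apply: degree_inM; last first.
  by rewrite -rmorph_prod; apply: degree_inC.
apply: (@degree_in_le _ _ _ (\sum_(i in I) (lo i == j))%N).
  apply: big_ord_eq_le1 => [i1 i2 /(congr1 val) /= /val_inj //|i /lt_k lt_i <-].
  exact: lt_i.
apply: degree_in_prod => i _; apply: degree_inD.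
  by rewrite -mpolyC1; apply: degree_inC.
exact/degree_inN/degree_inX.
Qed.

Lemma degree_in_Ehat p k (j : 'I_m.+1) : degree_in j (j < k)%N (Ehat m p k).
Proof.
apply: degree_in_sum => i _; rewrite -mulr_natr.
have -> : (-1) ^+ i * Fq m i k * ('C(k - i, p - i))%:R
  = ((-1) ^+ i * ('C(k - i, p - i))%:R) *: Fq m i k.
  by rewrite -mul_mpolyC rmorphM rmorphXn rmorphN rmorph1 rmorph_nat mulrAC.
exact/degree_inZ/degree_in_Fq.
Qed.

(** The variable of index j occurs, with degree at most one, only in the m - j factors with i >=
    j. *)
Lemma in_Lq_prod (c : 'I_m -> Zqx m) :
  (forall (i : 'I_m) (j : 'I_m.+1), degree_in j (j < i.+1)%N (c i)) ->
  in_Lq (\prod_(i < m) c i).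
Proof.
move=> deg_c mo mo_f j; move: mo mo_f; rewrite -[forall mo, _]/(degree_in _ _ _).
apply: degree_in_le (degree_in_prod _) => [|i _]; last exact: deg_c.
rewrite -(big_mkord xpredT (fun i => (j < i.+1)%N : nat)).
have le_jm : (j <= m)%N by rewrite -ltnS.
rewrite (big_cat_nat (leq0n j) le_jm) //= big_nat_cond big1 => [|i]; last by lia.
rewrite add0n (eq_big_nat _ _ (F2 := fun=> 1%N)) => [|i]; last by lia.
by rewrite sum_nat_const_nat muln1.
Qed.

Definition stair : {set {ffun 'I_m -> 'I_m.+1}} :=
  [set h : {ffun 'I_m -> 'I_m.+1} | [forall i : 'I_m, (h i <= i.+1)%N]].

(** Reversing the index turns the bound h i <= i + 1 into the exponent bound m - j, so that [stair]
    indexes both the monomials and the products of the e_p^k. *)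
Definition stair_mnm (h : {ffun 'I_m -> 'I_m.+1}) : 'X_{1.. m.+1} :=
  [multinom oapp (fun i => h (rev_ord i) : nat) 0%N (unlift ord_max j) | j < m.+1].

Lemma stair_mnm_lo h i : stair_mnm h (lo i) = h (rev_ord i).
Proof.
have -> : lo i = lift ord_max i by apply: val_inj; rewrite /= /bump leqNgt ltn_ord.
by rewrite mnmE liftK.
Qed.

Lemma stair_mnm_max h : stair_mnm h ord_max = 0%N.
Proof. by rewrite mnmE unlift_none. Qed.

Lemma stair_mnm_inj : injective stair_mnm.
Proof.
move=> h1 h2 eq_h; apply/ffunP=> i; apply: val_inj.
by rewrite /= -[i]rev_ordK -!stair_mnm_lo eq_h.
Qed.

Lemma stair_mnm_le h (j : 'I_m.+1) : h \in stair -> (stair_mnm h j <= m - j)%N.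
Proof.
rewrite inE => /forallP le_h; case: (unliftP ord_max j) => [i|] ->.
  have -> : lift ord_max i = lo i.
    by apply: val_inj; rewrite /= /bump leqNgt ltn_ord.
  by rewrite stair_mnm_lo (leq_trans (le_h _)) //= subnSK.
by rewrite stair_mnm_max.
Qed.

Lemma stair_mnmP (mo : 'X_{1.. m.+1}) : (forall j : 'I_m.+1, (mo j <= m - j)%N) ->
  exists2 h, h \in stair & mo = stair_mnm h.
Proof.
move=> le_mo.
have le_i (i : 'I_m) : (mo (lo (rev_ord i)) <= i.+1)%N.
  by apply: leq_trans (le_mo _) _; rewrite /= subKn.
have lt_i (i : 'I_m) : (mo (lo (rev_ord i)) < m.+1)%N.
  by apply: leq_ltn_trans (le_i i) _; rewrite ltnS.
exists [ffun i => inord (mo (lo (rev_ord i)))].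
  by rewrite inE; apply/forallP=> i; rewrite ffunE inordK.
apply/mnmP=> j; case: (unliftP ord_max j) => [i|] ->.
  have -> : lift ord_max i = lo i.
    by apply: val_inj; rewrite /= /bump leqNgt ltn_ord.
  by rewrite stair_mnm_lo ffunE inordK // rev_ordK.
by apply/eqP; rewrite stair_mnm_max -leqn0 (leq_trans (le_mo _)) //= subnn.
Qed.

(** Composing with this projection makes [Qhat], which is controlled only on L_n^q, a linear map on
    all polynomials, as [map_mpoly] requires. *)
Definition Lq_proj (f : Zqx m) : Zqx m :=
  \sum_(h in stair) f@_(stair_mnm h) *: 'X_[stair_mnm h].

Lemma Lq_proj_id f : in_Lq f -> Lq_proj f = f.
Proof.
move=> Lf; apply/mpolyP=> mo; rewrite raddf_sum /=.
under eq_bigr => h _ do rewrite mcoeffZ mcoeffX.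
have [|mo_notin] := boolP (mo \in msupp f).
  case/Lf/stair_mnmP => h st_h ->; rewrite (bigD1 h) //= eqxx mulr1 big1 ?addr0 //.
  by move=> g /andP[_ ne_g]; rewrite (inj_eq stair_mnm_inj) (negbTE ne_g) mulr0.
rewrite (memN_msupp_eq0 mo_notin) big1 // => h _.
by case: eqP => [->|_]; rewrite ?mulr0 // (memN_msupp_eq0 mo_notin) mul0r.
Qed.

Lemma Lq_projZD c f g : Lq_proj (c *: f + g) = c *: Lq_proj f + Lq_proj g.
Proof.
rewrite /Lq_proj scaler_sumr -big_split /=; apply: eq_bigr => h _.
by rewrite mcoeffD mcoeffZ scalerDl scalerA.
Qed.

Lemma in_Lq_proj f : in_Lq (Lq_proj f).
Proof.
move=> mo mo_f j; move: mo mo_f; rewrite -[forall mo, _]/(degree_in _ _ _).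
apply: degree_in_sum => h st_h; apply: degree_inZ => mo.
by rewrite msuppX inE => /eqP->; apply: stair_mnm_le.
Qed.

End Qhat.

(** A one-sided inverse of a square matrix over a commutative ring is two-sided; here rows and
    columns are indexed by a finite set. *)
Lemma inverse_sumC (R : comUnitRingType) (I : finType) (A : {set I}) (a b : I -> I -> R) :
  (forall f g, f \in A -> g \in A -> \sum_(h in A) a f h * b h g = (f == g)%:R) ->
  forall f g, f \in A -> g \in A -> \sum_(h in A) b f h * a h g = (f == g)%:R.
Proof.
move=> ab1 f g Af Ag; pose e (k : 'I_#|A|) := enum_val k.
pose Ma := \matrix_(k, l) a (e k) (e l); pose Mb := \matrix_(k, l) b (e k) (e l).
have /mulmx1C/matrixP/(_ (enum_rank_in Af f) (enum_rank_in Af g)) : Ma *m Mb = 1%:M.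
  apply/matrixP=> k l; rewrite !mxE -(inj_eq enum_val_inj) -ab1 ?enum_valP //.
  by rewrite [RHS]big_enum_val; apply: eq_bigr => r _; rewrite !mxE.
rewrite !mxE -(inj_eq enum_val_inj) !enum_rankK_in // => <-.
rewrite [LHS]big_enum_val; apply: eq_bigr => r _.
by rewrite !mxE /e !enum_rankK_in.
Qed.

(** * Existence of the quantization map *)

Section QhatExists.

Variable m : nat.

Let E (h : {ffun 'I_m -> 'I_m.+1}) : Zqx m := \prod_(i < m) elsym m (h i) i.+1.

Lemma stair_inord (p : 'I_m -> nat) : (forall i, (p i <= i.+1)%N) ->
  [ffun i => inord (p i)] \in stair m.
Proof.
move=> le_p; rewrite inE; apply/forallP=> i; rewrite ffunE inordK //.
by apply: leq_ltn_trans (le_p i) _; rewrite ltnS.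
Qed.

Lemma prod_inord (T : comNzRingType) (c : nat -> nat -> T) (p : 'I_m -> nat) :
  (forall i, (p i <= i.+1)%N) ->
  \prod_(i < m) c ([ffun i => inord (p i)] i : 'I_m.+1) i.+1 = \prod_(i < m) c (p i) i.+1.
Proof.
move=> le_p; apply: eq_bigr => i _; rewrite ffunE inordK //.
by apply: leq_ltn_trans (le_p i) _; rewrite ltnS.
Qed.

Lemma stair_monomial_span h : h \in stair m -> exists a : {ffun 'I_m -> 'I_m.+1} -> Zq m,
  'X_[stair_mnm h] = \sum_(g in stair m) a g *: E g.
Proof.
move=> st_h.
pose P (f : Zqx m) := exists a : {ffun 'I_m -> 'I_m.+1} -> Zq m,
  f = \sum_(g in stair m) a g *: E g.
(* The default 0 meets the bound m - j that [staircase_span] imposes for every natural j. *)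
pose a j := if (j < m)%N then stair_mnm h (inord j) else 0%N.
have -> : 'X_[stair_mnm h] = \prod_(j < m) ('X_(inord j) : Zqx m) ^+ a j.
  rewrite mpolyXE_id big_ord_recr /= -/(@ord_max m) stair_mnm_max expr0 mulr1.
  apply: eq_bigr => j _; rewrite /a ltn_ord.
  have -> : inord j = lo j by apply: val_inj; rewrite /= inordK // ltnS ltnW.
  by [].
apply: (@staircase_span _ m (fun j => 'X_(inord j)) P).
- split=> [|f [b ->]|f g [b ->] [c ->]].
  + by exists (fun=> 0); rewrite big1 // => g _; rewrite scale0r.
  + exists (fun g => - b g); rewrite -sumrN.
    by apply: eq_bigr => g _; rewrite scaleNr.
  exists (fun g => b g + c g); rewrite -big_split.
  by apply: eq_bigr => g' _; rewrite scalerDl.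
- move=> p le_p; exists (fun g => (g == [ffun i : 'I_m => inord (p i)])%:R).
  rewrite (bigD1 _ (stair_inord (fun i : 'I_m => le_p i))) /= eqxx scale1r.
  rewrite [X in _ + X]big1 ?addr0 => [|g /andP[_ /negbTE->]]; last by rewrite scale0r.
  rewrite /E (prod_inord (fun p k => elsym m p k) (fun i : 'I_m => le_p i)).
  by apply: eq_bigr => i _; rewrite elsymE.
move=> j; rewrite /a; case: ltnP => // lt_j.
by rewrite (leq_trans (stair_mnm_le _ st_h)) // inordK // ltnS ltnW.
Qed.

Lemma in_Lq_E h : in_Lq (E h).
Proof. by apply: in_Lq_prod => i j; apply: degree_in_elsym. Qed.

(* The monomials and the products of elementary symmetric polynomials are      *)
(* indexed by the same finite set, so that a one-sided inverse of the change   *)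
(* of basis is two-sided: spanning gives linear independence for free.         *)
Lemma Qhat_exists : exists Q, @is_Qhat m Q.
Proof.
have [a def_X] : exists a : {ffun 'I_m -> 'I_m.+1} -> {ffun 'I_m -> 'I_m.+1} -> Zq m,
    forall h, h \in stair m -> 'X_[stair_mnm h] = \sum_(g in stair m) a h g *: E g.
  apply: (@fin_all_exists _ _ (fun h (b : {ffun 'I_m -> 'I_m.+1} -> Zq m) => h \in stair m ->
    'X_[stair_mnm h] = \sum_(g in stair m) b g *: E g)) => h.
  have [/stair_monomial_span[b def_b]|_] := boolP (h \in stair m).
    by exists b.
  by exists (fun=> 0).
pose b h g := (E h)@_(stair_mnm g).
have def_E h : E h = \sum_(g in stair m) b h g *: 'X_[stair_mnm g].
  by rewrite -[LHS](Lq_proj_id (@in_Lq_E h)).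
have ab1 f g : f \in stair m -> g \in stair m ->
    \sum_(h in stair m) a f h * b h g = (f == g)%:R.
  move=> st_f st_g; have := congr1 (mcoeff (stair_mnm g)) (def_X f st_f).
  rewrite mcoeffX (inj_eq (@stair_mnm_inj m)) => ->; rewrite raddf_sum /=.
  by apply: eq_bigr => h _; rewrite mcoeffZ.
have ba1 := inverse_sumC ab1.
pose E' (h : {ffun 'I_m -> 'I_m.+1}) : Zqx m := \prod_(i < m) Ehat m (h i) i.+1.
(* Each staircase monomial is expanded in the products [E] by [a], and [E] is replaced by [E']; that
   [E h] goes to [E' h] is then [ba1]. *)
exists (fun f => \sum_(g in stair m) f@_(stair_mnm g) *:
  \sum_(h in stair m) a g h *: E' h); split.
- move=> f _ mo mo_f j; move: mo mo_f; rewrite -[forall mo, _]/(degree_in _ _ _).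
  apply: degree_in_sum => g _; apply/degree_inZ/degree_in_sum => h _.
  apply: degree_inZ => mo mo_h.
  apply: (@in_Lq_prod _ (fun i => Ehat m (h i) i.+1)) mo_h j => i k.
  exact: degree_in_Ehat.
- move=> c f g _ _; rewrite scaler_sumr -big_split /=; apply: eq_bigr => h _.
  by rewrite mcoeffD mcoeffZ scalerDl scalerA.
move=> p le_p; set h := [ffun i : 'I_m => inord (p i) : 'I_m.+1].
have st_h : h \in stair m := stair_inord le_p.
rewrite -(prod_inord (fun p k => elsym m p k) le_p) -/h.
rewrite -(prod_inord (fun p k => Ehat m p k) le_p) -/h -/(E h) -/(E' h).
under eq_bigr => g _ do rewrite scaler_sumr.
rewrite exchange_big /= (bigD1 h) //=.
have sum_ba g : g \in stair m ->
    \sum_(h' in stair m) (E h)@_(stair_mnm h') *: (a h' g *: E' g) = (h == g)%:R *: E' g.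
  move=> st_g; rewrite -(ba1 h g) // scaler_suml.
  by apply: eq_bigr => h' _; rewrite scalerA.
rewrite sum_ba // eqxx scale1r big1 ?addr0 // => g /andP[st_g ne_g].
by rewrite sum_ba // eq_sym (negbTE ne_g) scale0r.
Qed.

Lemma QhatP : is_Qhat (@Qhat m).
Proof. exact: epsilon_spec Qhat_exists. Qed.

End QhatExists.

(** * Quantization of the kernel *)

(** After exchanging the sums, the coefficient of (-1)^i F_i is z^i ((1 - z) + z)^(k-i) = z^i. *)
Lemma sum_binomial_inv (A : comNzRingType) (z : A) (F : nat -> A) k :
  \sum_(p < k.+1) (1 - z) ^+ (k - p) * z ^+ p *
     \sum_(i < p.+1) (-1) ^+ i * F i *+ 'C(k - i, p - i)
  = \sum_(i < k.+1) (-1) ^+ i * z ^+ i * F i.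
Proof.
pose G i p := (1 - z) ^+ (k - p) * z ^+ p * ((-1) ^+ i * F i *+ 'C(k - i, p - i)).
transitivity (\sum_(p < k.+1) \sum_(i < k.+1 | (i <= p)%N) G i p).
  apply: eq_bigr => p _; rewrite big_distrr /=.
  by rewrite (big_ord_widen k.+1 (fun i => G i p) (ltn_ord p)).
rewrite (exchange_big_dep xpredT) //=; apply: eq_bigr => i _.
rewrite -(big_geq_mkord i k.+1 xpredT (G i)) -{1}[i : nat]add0n big_addn big_mkord.
transitivity (\sum_(d < (k - i).+1) (-1) ^+ i * z ^+ i * F i *
    ((1 - z) ^+ (k - i - d) * z ^+ d *+ 'C(k - i, d))).
  rewrite subSn ?leq_ord //; apply: eq_bigr => d _.
  rewrite /G addnK exprD [(d + i)%N]addnC subnDA !mulrnAr; congr (_ *+ _).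
  move: ((1 - z) ^+ _) (z ^+ d) (z ^+ i) ((-1) ^+ i).
  by move=> *; ring.
have := exprDn (1 - z) z (k - i); rewrite subrK expr1n => binom1.
by rewrite -big_distrr /= -binom1 mulr1.
Qed.

Definition quantize m (f : Zqx m) : Zqx m := Qhat (Lq_proj f).

Lemma quantizeZD m c (f g : Zqx m) :
  quantize (c *: f + g) = c *: quantize f + quantize g.
Proof.
have [_ QZD _] := QhatP m.
by rewrite /quantize Lq_projZD QZD //; apply: in_Lq_proj.
Qed.

Lemma quantize_is_zmod_morphism m : zmod_morphism (@quantize m).
Proof. by move=> f g; rewrite addrC -scaleN1r quantizeZD scaleN1r addrC. Qed.

HB.instance Definition _ m :=
  GRing.isZmodMorphism.Build _ _ (@quantize m) (@quantize_is_zmod_morphism m).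

Lemma Lq_proj_is_zmod_morphism m : zmod_morphism (@Lq_proj m).
Proof. by move=> f g; rewrite addrC -scaleN1r Lq_projZD scaleN1r addrC. Qed.

HB.instance Definition _ m :=
  GRing.isZmodMorphism.Build _ _ (@Lq_proj m) (@Lq_proj_is_zmod_morphism m).

Lemma quantizeZ m c (f : Zqx m) : quantize (c *: f) = c *: quantize f.
Proof. by have := quantizeZD c f 0; rewrite raddf0 !addr0. Qed.

Lemma Lq_projZ m c (f : Zqx m) : Lq_proj (c *: f) = c *: Lq_proj f.
Proof. by have := Lq_projZD c f 0; rewrite raddf0 !addr0. Qed.

Section KernelExpansion.

Variable m : nat.

(** The coefficient ring is a parameter: over [Zq m] the weight visibly contains no y, which lets
    [map_stair_sum] treat its coefficients as scalars. *)
Definition stair_weight (A : nzRingType) (i : 'I_m) (p : nat) : {mpoly A[m.+1]} :=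
  'X_(lo (rev_ord i)) ^+ (i.+1 - p) * (1 - 'X_(lo (rev_ord i))) ^+ p.

Definition stair_sum (c : nat -> nat -> Zqx m) : Zqxy m :=
  \prod_(i < m) \sum_(p < i.+2) stair_weight (Zqx m) i p * (c p i.+1)%:MP.

Lemma stair_sumE c : stair_sum c = \sum_(h in stair m)
  (\prod_(i < m) stair_weight (Zqx m) i (h i)) * (\prod_(i < m) c (h i) i.+1)%:MP.
Proof.
pose F i p := stair_weight (Zqx m) i p * (c p i.+1)%:MP.
have widen_F (i : 'I_m) : \sum_(p < i.+2) F i p
    = \sum_(p < m.+1 | (p < i.+2)%N) F i p.
  by rewrite (big_ord_widen m.+1 (F i)) // !ltnS.
rewrite /stair_sum (eq_bigr _ (fun i _ => widen_F i)).
rewrite (bigA_distr_big_dep (fun (i : 'I_m) (p : 'I_m.+1) => (p < i.+2)%N)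
  (fun i p => F i p)) /=; apply: eq_big => [h|h _].
  rewrite [RHS]inE; apply/familyP/forallP => le_h i; exact: le_h.
rewrite [LHS]big_split /=; congr (_ * _).
exact/esym/(rmorph_prod (@mpolyC m.+1 (Zqx m))).
Qed.

Lemma map_stair_sum (phi : {additive Zqx m -> Zqx m})
    (c c' : nat -> nat -> Zqx m) :
  (forall a f, phi (a *: f) = a *: phi f) ->
  (forall h : {ffun 'I_m -> 'I_m.+1}, h \in stair m ->
     phi (\prod_(i < m) c (h i) i.+1) = \prod_(i < m) c' (h i) i.+1) ->
  map_mpoly phi (stair_sum c) = stair_sum c'.
Proof.
move=> phiZ phi_c; rewrite !stair_sumE raddf_sum /=; apply: eq_bigr => h st_h.
rewrite -phi_c //; move: (\prod_(i < m) c _ _) => f.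
have -> : \prod_(i < m) stair_weight (Zqx m) i (h i) =
    map_mpoly (@mpolyC m.+1 (Zq m)) (\prod_(i < m) stair_weight (Zq m) i (h i)).
  rewrite rmorph_prod; apply: eq_bigr => i _.
  rewrite /stair_weight (rmorphM (map_mpoly (@mpolyC m.+1 (Zq m)))) /=.
  rewrite !(rmorphXn (map_mpoly (@mpolyC m.+1 (Zq m)))) /=.
  rewrite (rmorphB (map_mpoly (@mpolyC m.+1 (Zq m)))) /=.
  by rewrite (rmorph1 (map_mpoly (@mpolyC m.+1 (Zq m)))) map_mpolyX.
move: (\prod_(i < m) _) => u; apply/mpolyP=> mo.
rewrite mcoeff_map_mpoly [X in phi X@__]mulrC [in RHS]mulrC.
rewrite [in LHS]mcoeffCM [in RHS]mcoeffCM.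
rewrite mcoeff_map_mpoly [X in phi X]mulrC [RHS]mulrC.
by rewrite [X in phi X]mul_mpolyC [RHS]mul_mpolyC phiZ.
Qed.

Lemma kernel_stair_sum : kernel m (Zq m) = stair_sum (elsym m).
Proof.
rewrite kernel_prod; apply: eq_bigr => i _.
pose y j : Zqx m := 'X_(inord j).
apply: etrans (prod_addM_elem_sym (@mpolyC m.+1 (Zqx m)) y i.+1 _ _) _.
by apply: eq_bigr => p _; rewrite elsymE.
Qed.

Lemma Fq0 k : Fq m 0 k = 1.
Proof.
rewrite /Fq (big_pred1 set0) => [|I].
  by rewrite !big_pred0 ?mulr1 // => i; rewrite inE.
rewrite cards_eq0; apply: andb_idr => /eqP->.
by apply/forallP=> i; rewrite inE.
Qed.

Lemma qdgroth_w0_stair_sum : qdgroth_w0 m = stair_sum (Ehat m).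
Proof.
apply: eq_bigr => i _; set z := 1 - 'X_(lo (rev_ord i)).
have eq_x : 'X_(lo (rev_ord i)) = 1 - z by rewrite opprB addrC subrK.
transitivity (\sum_(j < i.+2) (-1) ^+ j * z ^+ j * (Fq m j i.+1)%:MP).
  rewrite -(big_mkord xpredT (fun j => (-1) ^+ j * z ^+ j * (Fq m j i.+1)%:MP)).
  by rewrite [RHS]big_ltn // Fq0 !expr0 !mul1r.
apply: etrans (esym (sum_binomial_inv z (fun j => (Fq m j i.+1)%:MP) i.+1)) _.
apply: eq_bigr => p _; rewrite /stair_weight -/z -eq_x; congr (_ * _).
rewrite /Ehat (rmorph_sum (@mpolyC m.+1 (Zqx m))) /=; apply: eq_bigr => j _.
rewrite (rmorphMn (@mpolyC m.+1 (Zqx m))) (rmorphM (@mpolyC m.+1 (Zqx m))) /=.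
by rewrite (rmorphXn (@mpolyC m.+1 (Zqx m))) (rmorphN1 (@mpolyC m.+1 (Zqx m))).
Qed.

End KernelExpansion.

Theorem corollary8p10 (m : nat) (w : 'S_m.+1) :
  qgroth w = y_zero (swap_xy (qdgroth w^-1%g)).
Proof.
have [_ _ QE] := QhatP m.
have LE (h : {ffun 'I_m -> 'I_m.+1}) : Lq_proj (\prod_(i < m) elsym m (h i) i.+1)
    = \prod_(i < m) elsym m (h i) i.+1.
  by apply: Lq_proj_id; apply: in_Lq_prod => i j; apply: degree_in_elsym.
have proj_k : map_mpoly (@Lq_proj m) (kernel m (Zq m)) = kernel m (Zq m).
  rewrite kernel_stair_sum.
  by apply: map_stair_sum => [|h _]; [exact: Lq_projZ|exact: LE].
have quant_k : map_mpoly (@quantize m) (kernel m (Zq m)) = qdgroth_w0 m.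
  rewrite kernel_stair_sum qdgroth_w0_stair_sum.
  apply: map_stair_sum => [|h st_h]; first exact: quantizeZ.
  rewrite -[LHS]/(Qhat (Lq_proj (\prod_(i < m) elsym m (h i) i.+1))) LE.
  by rewrite (QE (fun i => h i)) // => i; move: st_h; rewrite inE => /forallP.
pose f := piperm (permcomp w^-1%g (w0 m))
  (\prod_(i < m) 'X_(lo i) ^+ (m - i) : Zqx m).
(* Membership of the Grothendieck polynomial in L_n^q: the projection fixes the kernel, hence also
   the constant term of its image under the x operators. *)
have Lq_f : Lq_proj f = f.
  by apply: etrans (additive_piperm w proj_k) _; apply: piperm_kernel.
apply: etrans (etrans _ (additive_piperm w quant_k)) _; last first.
  by rewrite /qdgroth invgK; apply/esym/y_zero_swap_xy.
(* What remains is that extending scalars from Z to Z[q] commutes with the operators. *)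
rewrite -[RHS]/(Qhat (Lq_proj f)) Lq_f /qgroth; congr (Qhat _).
rewrite /groth (map_piperm (@mpolyC m int)); congr (piperm _ _).
rewrite (rmorph_prod (map_mpoly (@mpolyC m int))); apply: eq_bigr => i _.
rewrite (rmorphXn (map_mpoly (@mpolyC m int))); congr (_ ^+ _).
exact: (map_mpolyX (@mpolyC m int)).
Qed.
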